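(* There exist universal constants $C,c>0$ such that for every $n\ge 1$, every generalized Orlicz ball $K\subset\mathbb{R}^n$ in isotropic position with constant $L_K$, and every $t>0$, if $X_1,\dots,X_n$ are the coordinates of a random vector uniformly distributed on $K$, then $$\mathbb{P}\Big(\Big|\frac{\sum_{i=1}^nX_i^2}{n}-L_K^2\Big|>t\Big)\le Ce^{-cnt^2}+Cn\,e^{-c\sqrt[3]{nt}}.$$
   Context: A function $f:[0,\infty)\to[0,\infty]$ is a Young function if it is convex, $f(0)=0$, $f(x)\neq 0$ for some $x$, and $f(x)\neq\infty$ for some $x\neq 0$. Given $n$ Young functions $f_1,\dots,f_n$, the set $K=\{(x_1,\dots,x_n)\in\mathbb{R}^n:\sum_{i=1}^n f_i(|x_i|)\le 1\}$ is called a generalized Orlicz ball. Uniform distribution on $K$ means normalized Lebesgue measure on $K$. Such a $K$ is in isotropic position if its Lebesgue measure is $1$ and there is a constant $L_K>0$ with $\mathbb{E}X_i^2=L_K^2$ for all $i=1,\dots,n$, where $(X_1,\dots,X_n)$ is uniformly distributed on $K$. *)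

(* Defs.v *)
From HB Require Import structures.
From mathcomp Require Import all_boot all_order all_algebra.
From mathcomp Require Import all_classical all_reals all_analysis.
From mathcomp Require Import measurable_realfun.
Set Implicit Arguments.
Unset Strict Implicit.
Unset Printing Implicit Defensive.
Import Order.TTheory GRing.Theory Num.Theory.
Import numFieldNormedType.Exports.
Local Open Scope classical_set_scope.
Local Open Scope ring_scope.

(* R^n is [n.-tuple R], which the library equips with the sigma-algebra
   generated by the coordinate maps, i.e. the Borel sigma-algebra. *)

Section lebesgue_cons.
Context (R : realType) (n : nat).
Variable m : {sigma_finite_measure set (n.-tuple R) -> \bar R}.

Definition cons_pair (p : measurableTypeR R * n.-tuple R) : n.+1.-tuple R :=
  [tuple of p.1 :: p.2].

Let measurable_cons_pair :
  measurable_fun [set: measurableTypeR R * n.-tuple R] cons_pair.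
Proof. exact: measurable_cons. Qed.

HB.instance Definition _ :=
  isMeasurableFun.Build _ _ _ _ cons_pair measurable_cons_pair.

Definition lebesgue_cons : set (n.+1.-tuple R) -> \bar R :=
  pushforward (lebesgue_measure \x m)%E cons_pair.

Let lebesgue_cons0 : lebesgue_cons set0 = 0%E.
Proof. exact: measure0. Qed.

Let lebesgue_cons_ge0 A : (0 <= lebesgue_cons A)%E.
Proof. exact: measure_ge0. Qed.

Let lebesgue_cons_sigma_additive : semi_sigma_additive lebesgue_cons.
Proof. exact: measure_semi_sigma_additive. Qed.

HB.instance Definition _ := isMeasure.Build _ _ _ lebesgue_cons
  lebesgue_cons0 lebesgue_cons_ge0 lebesgue_cons_sigma_additive.

Let lebesgue_cons_sigma_finite : sigma_finite setT lebesgue_cons.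
Proof.
have /sigma_finiteP[F [TF ndF Foo]] := sigma_finiteT (@lebesgue_measure R).
have /sigma_finiteP[G [TG ndG Goo]] := sigma_finiteT m.
pose u (x : n.+1.-tuple R) : measurableTypeR R * n.-tuple R :=
  (thead x, [tuple of behead x]).
have mu : measurable_fun setT u.
  apply/measurable_fun_pair => /=; last exact: measurable_behead.
  exact: measurable_tnth.
have uK : cancel cons_pair u by move=> [x t]; congr pair; apply/val_inj.
exists (fun k => u @^-1` (F k `*` G k)).
  rewrite -preimage_bigcup [X in u @^-1` X](_ : _ = setT) ?preimage_setT//.
  rewrite -setXTT TF TG; apply/seteqP; split=> -[x y] /=.
    by move=> [k _ [Fx Gy]]; split; exists k.
  move=> [[j _ Fx] [k _ Gy]]; exists (maxn j k) => //; split.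
    by move: x Fx; exact/subsetPset/ndF/leq_maxl.
  by move: y Gy; exact/subsetPset/ndG/leq_maxr.
move=> k; have [mF Fk] := Foo k; have [mG Gk] := Goo k; split.
  by rewrite -[X in measurable X]setTI; apply: mu => //; exact: measurableX.
rewrite /lebesgue_cons /pushforward -comp_preimage (_ : u \o _ = id); last first.
  exact/funext.
by rewrite preimage_id product_measure1E// lte_mul_pinfty// ge0_fin_numE.
Qed.

HB.instance Definition _ := @Measure_isSigmaFinite.Build _ _ _
  lebesgue_cons lebesgue_cons_sigma_finite.

Lemma lebesgue_consE (A : set R) (B : set (n.-tuple R)) :
  measurable A -> measurable B ->
  lebesgue_cons [set x | A (thead x) /\ B [tuple of behead x]] =
  (lebesgue_measure A * m B)%E.
Proof.
move=> mA mB; rewrite -product_measure1E//; congr (product_measure1 _ _ _).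
by apply/seteqP; split=> -[x t] /= [] Ax Bt; split => //=; move: Bt;
  congr (B _); exact/val_inj.
Qed.

End lebesgue_cons.

(* Lebesgue measure on R^n, as an n-fold product; see [lebesgue_tuple_box]. *)
Fixpoint lebesgue_tuple (R : realType) (n : nat) :
    {sigma_finite_measure set (n.-tuple R) -> \bar R} :=
  match n with
  | 0%N => dirac [tuple]
  | k.+1 => lebesgue_cons (lebesgue_tuple R k)
  end.

Lemma lebesgue_tuple_box (R : realType) (n : nat) (A : 'I_n -> set R) :
  (forall i, measurable (A i)) ->
  lebesgue_tuple R n [set x | forall i, A i (tnth x i)] =
  (\prod_(i < n) lebesgue_measure (A i))%E.
Proof.
elim: n A => [|n IH] A mA.
  by rewrite big_ord0 /= /dirac indicE mem_set//; move=> [].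
rewrite big_ord_recl -IH//= -lebesgue_consE//; last first.
  set B := [set _ | _].
  rewrite (_ : B =
      \bigcap_(i in [set: 'I_n]) ((@tnth n R)^~ i @^-1` A (lift ord0 i))).
    apply: fin_bigcap_measurable => // i _.
    by rewrite -[X in measurable X]setTI; exact: measurable_tnth.
  by apply/seteqP; split=> t /= tA i; have := tA i => //; apply.
congr lebesgue_cons; apply/seteqP; split => x /=.
  move=> xA; split; first exact: xA.
  move=> i; have := xA (lift ord0 i).
  by rewrite [in X in X -> _](tuple_eta x) tnthS.
move=> [x0 xA] i; case: (unliftP ord0 i) => [j ->|->]//.
by rewrite (tuple_eta x) tnthS.
Qed.

(* Total in K: when K is not measurable or its volume is 0 or +oo, the value is
   an arbitrary fixed probability; otherwise see [uniform_onE]. *)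
Definition uniform_on (R : realType) (n : nat) (K : set (n.-tuple R)) :
    probability (n.-tuple R) R :=
  match pselect (measurable K) with
  | left mK => mnormalize (mrestr (lebesgue_tuple R n) mK) point
  | right _ => point
  end.

Lemma uniform_onE (R : realType) (n : nat) (K : set (n.-tuple R)) :
  measurable K -> (0 < lebesgue_tuple R n K < +oo)%E ->
  forall A, uniform_on K A =
    (lebesgue_tuple R n (A `&` K) * (fine (lebesgue_tuple R n K))^-1%:E)%E.
Proof.
move=> mK K0oo A; rewrite /uniform_on; case: pselect => // mK'.
have mnormE (mu : {measure set (n.-tuple R) -> \bar R}) :
    (0 < mu setT < +oo)%E ->
    mnormalize mu point A = (mu A * (fine (mu setT))^-1%:E)%E.
  by move=> /andP[mu0 muoo]; rewrite /mnormalize gt_eqF//= lt_eqF.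
rewrite -[in fine _](setTI K); apply: (mnormE (mrestr _ mK')).
by rewrite /= /mrestr setTI.
Qed.

(* Functions [0, +oo[ -> [0, +oo]: values at negative arguments are irrelevant. *)
Definition young_function (R : realType) (f : R -> \bar R) : Prop :=
  [/\ forall x : R, 0 <= x -> (0 <= f x)%E,
      forall x y t : R, 0 <= x -> 0 <= y -> 0 <= t <= 1 ->
        (f (t * x + (1 - t) * y)%R <= t%:E * f x + (1 - t)%:E * f y)%E,
      f 0 = 0%E,
      exists2 x : R, 0 <= x & f x <> 0%E &
      exists2 x : R, 0 < x & f x <> +oo%E].

Definition orlicz_ball (R : realType) (n : nat) (f : 'I_n -> R -> \bar R) :
    set (n.-tuple R) :=
  [set x | (\sum_(i < n) f i `|tnth x i|%R <= 1)%E].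

Definition generalized_orlicz_ball (R : realType) (n : nat)
    (K : set (n.-tuple R)) : Prop :=
  exists2 f : 'I_n -> R -> \bar R,
    forall i, young_function (f i) & K = orlicz_ball f.

Lemma young_function_nondecreasing (R : realType) (f : R -> \bar R) :
  young_function f -> forall x y : R, 0 <= x -> x <= y -> (f x <= f y)%E.
Proof.
move=> [f0 fc fz _ _] x y x0; rewrite le_eqVlt => /predU1P[->//|xy].
have y0 : 0 < y by exact: le_lt_trans xy.
have t01 : 0 <= x / y <= 1.
  by rewrite divr_ge0 ?(ltW y0)//= ler_pdivrMr// mul1r ltW.
have := fc y 0 (x / y) (ltW y0) (lexx _) t01.
rewrite mulr0 addr0 divfK ?gt_eqF// fz mule0 adde0 => /le_trans; apply.
by apply: gee_pMl => //; [exact/f0/ltW|case/andP: t01].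
Qed.

Lemma measurable_orlicz_ball (R : realType) (n : nat) (K : set (n.-tuple R)) :
  generalized_orlicz_ball K -> measurable K.
Proof.
move=> [f yf ->].
pose g i (x : R) := f i `|x|.
have mf i : measurable_fun [set: R] (g i).
  apply: (measurability (@ErealGenInftyO.G R)) => [|/= _ [_] [r] -> <-].
    exact: ErealGenInftyO.measurableE.
  rewrite setTI; apply: is_interval_measurable => s t/=.
  rewrite !in_itv/= /g => fs ft u /andP[su ut].
  rewrite in_itv/= /g.
  have [u0|u0] := leP 0 u.
    apply: le_lt_trans ft; apply: (young_function_nondecreasing (yf i)) => //.
    by rewrite ger0_norm// (le_trans ut)// ler_norm.
  apply: le_lt_trans fs; apply: (young_function_nondecreasing (yf i)) => //.
  by rewrite ltr0_norm// ltr0_norm ?lerN2// (le_lt_trans su).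
pose s (x : n.-tuple R) := (\sum_(i < n) g i (tnth x i))%E.
have ms : measurable_fun [set: n.-tuple R] s.
  apply: emeasurable_sum => i.
  by apply: (measurableT_comp (mf i)); exact: measurable_tnth.
by rewrite /orlicz_ball -[X in measurable X]setTI; exact: emeasurable_fun_infty_c.
Qed.

Definition isotropic_with_constant (R : realType) (n : nat)
    (K : set (n.-tuple R)) (L : R) : Prop :=
  [/\ lebesgue_tuple R n K = 1%E, 0 < L &
      forall i : 'I_n,
        ('E_(uniform_on K)[fun x : n.-tuple R => (tnth x i ^+ 2)%R] =
         (L ^+ 2)%:E)%E].

(* Quantified over measurable sets only: both sides are meaningless elsewhere. *)
Definition uniformly_distributed (d : measure_display) (T : measurableType d)
    (R : realType) (P : probability T R) (n : nat) (X : {RV P >-> n.-tuple R})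
    (K : set (n.-tuple R)) : Prop :=
  forall A : set (n.-tuple R), measurable A ->
    distribution P X A = uniform_on K A.

(* Main.v *)
Require Import Defs.
From HB Require Import structures.
From mathcomp Require Import all_boot all_order all_algebra.
From mathcomp Require Import all_classical all_reals all_analysis.
From mathcomp Require Import measurable_realfun.
From mathcomp Require Import ring lra.
Import Order.TTheory GRing.Theory Num.Theory.
Import numFieldNormedType.Exports.
Local Open Scope classical_set_scope.
Local Open Scope ring_scope.
Set Implicit Arguments.
Unset Strict Implicit.
Unset Printing Implicit Defensive.

(* Write N_J(s) for the volume of the x with |x_i| in J_i and sum f_i(|x_i|) <= s.
   It is obtained from the indicator of [0, +oo[ by the operators
   N |-> (s |-> \int g(x) N(s - f_i(x)) dx), which commute and, when g is the
   indicator of an interval, preserve log-concavity (Prekopa).  Log-concavity of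
   N makes the kernel N(s - f_i(x)) totally positive, so that restricting one
   more coordinate to an up-set (down-set) multiplies N by a factor monotone in
   s.  By Chebyshev's integral inequality this yields negative orthant dependence:
   E prod g_i(|X_i|) <= prod E g_i(|X_i|) if all g_i are nondecreasing or all are
   nonincreasing.

   The marginals have log-concave densities.  Comparing the volume of a small box
   with the product of the probabilities P(|X_i| < e) gives L_K <= 1, hence
   uniform exponential tails.  The lower tail follows from Chernoff's method; for
   the upper tail the squares are first truncated at level (nt)^(2/3), which
   produces the cube root. *)

(** * Iterated slice integrals *)

(** The coordinates are dependent, and exponential tails do not control the mean of e^{la x^2}.
    Negative dependence stands in for independence, but only for products of functions of the |x_i|
    that are monotone in a common direction; hence two separate weights, increasing in x^2 for the
    upper tail and decreasing for the lower one. On the truncated range |x| <= u, expanding e^{la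
    x^2} to second order requires la u^2 <= 1/2, so the Chernoff exponent is at most of order n t /
    u^2, while a coordinate exceeds u with probability at most 4 e^{-u/4}. These two balance at u^3
    = n t. Volume is followed as a function of the level s because fixing one coordinate x of a ball
    at level s leaves a ball at level s - f(x) in the others, so inductions on the dimension stay in
    one family. As the slice operators commute, a coordinate that has been dealt with can be moved
    into the base profile, over which the inductions are generalised. *)

Section slices.
Context {R : realType}.
Local Notation mu := (@lebesgue_measure R).
Implicit Types (x y : R) (f : R -> \bar R) (g : R -> R) (N : R -> \bar R).

(* x |-> N (s - f x), extended by 0 where x < 0 or f x = +oo; the norm only makes
   it measurable on all of R, as f is arbitrary at negative arguments. *)
Definition slack f N (s x : R) : \bar R :=
  if (0 <= x)%R && (f `|x|%R < +oo)%E then N (s - fine (f `|x|))%R else 0%E.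

Definition wint f g N (s : R) : \bar R :=
  (\int[mu]_x ((g x)%:E * slack f N s x))%E.

Fixpoint iwint n : ('I_n -> R -> \bar R) -> ('I_n -> R -> R) ->
    (R -> \bar R) -> R -> \bar R :=
  match n as m return ('I_m -> R -> \bar R) -> ('I_m -> R -> R) ->
    (R -> \bar R) -> R -> \bar R with
  | 0%N => fun _ _ N => N
  | k.+1 => fun F G N => wint (F ord0) (G ord0)
      (iwint (fun i => F (lift ord0 i)) (fun i => G (lift ord0 i)) N)
  end.

(** Finiteness allows cross-multiplied ratios to be cancelled. Vanishing at negative levels makes
    every slice boundedly supported, since Young functions are unbounded. *)
Definition profile N : Prop :=
  [/\ forall s, (0 <= N s < +oo)%E,
      forall s t, s <= t -> (N s <= N t)%E &
      forall s, s < 0 -> N s = 0%E].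

Definition weight g : Prop :=
  measurable_fun setT g /\ exists B, forall x, 0 <= g x <= B.

(** Covers the unbounded weights x^2, x^4 and e^{x/4}; boundedness, as in [weight], is what keeps
    the result of [wint] a profile. *)
Definition nnweight g : Prop := measurable_fun setT g /\ forall x, 0 <= g x.

Lemma young_ge0 f x : young_function f -> (0 <= f `|x|%R)%E.
Proof. by case=> + _ _ _ _; exact. Qed.

Lemma young_norm_le f x y : young_function f -> `|x| <= `|y| ->
  (f `|x|%R <= f `|y|%R)%E.
Proof. by move=> yf; apply: (young_function_nondecreasing yf). Qed.

Lemma measurable_young f : young_function f ->
  measurable_fun setT (fun x : R => f `|x|).
Proof.
move=> yf; apply: (measurability (@ErealGenInftyO.G R)) => [|/= _ [_] [r] -> <-].
  exact: ErealGenInftyO.measurableE.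
rewrite setTI; apply: is_interval_measurable => s t/=.
rewrite !in_itv/= => fs ft u /andP[su ut]; rewrite in_itv/=.
have [u0|u0] := leP 0 u.
  apply: le_lt_trans ft; apply: young_norm_le => //.
  by rewrite ger0_norm// (le_trans ut)// ler_norm.
apply: le_lt_trans fs; apply: young_norm_le => //.
by rewrite ltr0_norm// ltr0_norm ?lerN2// (le_lt_trans su).
Qed.

Lemma profile_ge0 N s : profile N -> (0 <= N s)%E.
Proof. by case=> /(_ s) /andP[]. Qed.

Lemma measurable_nondecreasing N : (forall s t : R, s <= t -> (N s <= N t)%E) ->
  measurable_fun setT N.
Proof.
move=> ndN.
apply: (measurability (@ErealGenInftyO.G R)) => [|/= _ [_] [r] -> <-].
  exact: ErealGenInftyO.measurableE.
rewrite setTI; apply: is_interval_measurable => s t/=.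
rewrite !in_itv/= => Ns Nt u /andP[su ut]; rewrite in_itv/=.
exact: le_lt_trans (ndN _ _ ut) Nt.
Qed.

Lemma measurable_profile N : profile N -> measurable_fun setT N.
Proof. by case=> _ ndN _; exact: measurable_nondecreasing. Qed.

Lemma weight_ge0 g x : weight g -> 0 <= g x.
Proof. by case=> _ [B] /(_ x)/andP[]. Qed.

Lemma weight_nn g : weight g -> nnweight g.
Proof. by move=> wg; split=> [|x]; [exact: wg.1|exact: weight_ge0]. Qed.

Lemma measurable_dom f d (T : measurableType d) (xi : T -> R) :
  young_function f -> measurable_fun setT xi ->
  measurable_fun setT (fun t => (0 <= xi t) && (f `|xi t|%R < +oo)%E).
Proof.
move=> yf mxi; apply: measurable_and; first exact: measurable_fun_ler.
apply: measurable_fun_lte => //.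
exact: (measurableT_comp (measurable_young yf)).
Qed.

Lemma measurable_slack f N d (T : measurableType d) (sigma xi : T -> R) :
  young_function f -> measurable_fun setT N ->
  measurable_fun setT sigma -> measurable_fun setT xi ->
  measurable_fun setT (fun t => slack f N (sigma t) (xi t)).
Proof.
move=> yf mN ms mx; apply: measurable_fun_ifT => //.
  exact: measurable_dom.
apply: (measurableT_comp mN); apply: measurable_funB => //.
apply: measurableT_comp; first exact: fine_measurable.
exact: (measurableT_comp (measurable_young yf)).
Qed.

Lemma slack_ge0 f N s x : (forall s, (0 <= N s)%E) -> (0 <= slack f N s x)%E.
Proof. by move=> N0; rewrite /slack; case: ifP. Qed.

Lemma measurable_wintegrand f g N s : young_function f ->
  measurable_fun setT g -> measurable_fun setT N ->
  measurable_fun setT (fun x => (g x)%:E * slack f N s x)%E.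
Proof.
move=> yf mg mN; apply: emeasurable_funM; first exact/measurable_EFinP.
exact: measurable_slack.
Qed.

Lemma wintegrand_ge0 f g N s x : (forall s, (0 <= N s)%E) ->
  (forall x, 0 <= g x) -> (0 <= (g x)%:E * slack f N s x)%E.
Proof.
by move=> N0 g0; apply: mule_ge0; [rewrite lee_fin|exact: slack_ge0].
Qed.

Lemma wint_ge0 f g N s : (forall s, (0 <= N s)%E) -> (forall x, 0 <= g x) ->
  (0 <= wint f g N s)%E.
Proof. by move=> N0 g0; apply: integral_ge0 => x _; exact: wintegrand_ge0. Qed.

Lemma wint_nondecreasing f g N s t : young_function f -> nnweight g ->
  (forall s, 0 <= N s)%E -> (forall s t : R, s <= t -> (N s <= N t)%E) ->
  s <= t -> (wint f g N s <= wint f g N t)%E.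
Proof.
move=> yf [mg g0] N0 ndN st; have mN := measurable_nondecreasing ndN.
apply: ge0_le_integral => //.
- by move=> x _; exact: wintegrand_ge0.
- exact: measurable_wintegrand.
- exact: measurable_wintegrand.
- move=> x _; apply: lee_wpmul2l; first by rewrite lee_fin.
  by rewrite /slack; case: ifP => // _; apply: ndN; rewrite lerB.
Qed.

(** Convexity and f 0 = 0 give f x >= (x / x0) f x0 for x >= x0, hence linear growth as soon as f x0
    > 0. *)
Lemma young_unbounded f (y : R) : young_function f ->
  exists b, 0 < b /\ forall x, b < x -> (y%:E < f x)%E.
Proof.
move=> [f0 fc fz [x0 x00 fx0] _].
have {}x00 : 0 < x0.
  by rewrite lt_neqAle x00 andbT; apply: contra_notN fx0 => /eqP <-.
have fx0p : (0 < f x0)%E by rewrite lt_neqAle f0 ?ltW// andbT eq_sym; exact/eqP.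
(* A real minorant [v] of f x0 is used because f x0 may be infinite. *)
have [v v0 vf] : exists2 v : R, 0 < v & (v%:E <= f x0)%E.
  move: fx0p; case: (f x0) => [r| |]//.
    by rewrite lte_fin => r0; exists r.
  by move=> _; exists 1 => //; rewrite leey.
have q0 : 0 <= x0 * `|y| / v by rewrite divr_ge0// ?mulr_ge0// ltW.
exists (x0 + x0 * `|y| / v); split; first by rewrite ltr_pwDl.
move=> x bx.
have x0x : x0 < x by apply: le_lt_trans bx; rewrite lerDl.
have xp : 0 < x := lt_trans x00 x0x.
have t01 : 0 <= x0 / x <= 1.
  by rewrite ler_pdivrMr// mul1r (ltW x0x) divr_ge0// ltW.
have := fc x 0 (x0 / x) (ltW xp) (lexx _) t01.
rewrite mulr0 addr0 divfK ?gt_eqF// fz mule0 adde0 => /(le_trans vf) h.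
have : (f x != -oo)%E by have := f0 x (ltW xp); case: (f x).
move: h; case: (f x) => [r| |]// h _; last by rewrite ltry.
rewrite -EFinM lee_fin in h; rewrite lte_fin.
have {}h : v * x <= x0 * r.
  by rewrite -ler_pdivlMr// mulrAC.
have h1 : x0 * `|y| + v * x0 < v * x.
  move: bx; rewrite -(ltr_pM2l v0) mulrDr.
  have -> : v * (x0 * `|y| / v) = x0 * `|y| by field; rewrite gt_eqF.
  by rewrite addrC.
rewrite -(ltr_pM2l x00); apply: lt_le_trans h.
have : x0 * y <= x0 * `|y| by rewrite ler_pM2l// ler_norm.
have := mulr_gt0 v0 x00; lra.
Qed.

Lemma profile_slack_le f N s x : young_function f -> profile N ->
  (slack f N s x <= N s)%E.
Proof.
move=> yf pN; rewrite /slack; case: ifP => _; last exact: profile_ge0.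
case: pN => _ + _; apply; rewrite gerBl fine_ge0//; exact: young_ge0.
Qed.

Lemma profile_slack_bound f N s : young_function f -> profile N ->
  exists b, 0 < b /\ forall x, b < x -> slack f N s x = 0%E.
Proof.
move=> yf pN; have [b [b0 hb]] := young_unbounded s yf.
exists b; split=> // x bx; rewrite /slack; case: ifP => // /andP[x0 fx].
case: pN => _ _; apply; rewrite subr_lt0 -lte_fin fineK.
  by rewrite (ger0_norm x0); exact: hb.
by rewrite ge0_fin_numE// young_ge0.
Qed.

Lemma profile_slack_lty f N s x : young_function f -> profile N ->
  (slack f N s x < +oo)%E.
Proof.
move=> yf pN; apply: le_lt_trans (profile_slack_le s x yf pN) _.
by case: pN => /(_ s)/andP[].
Qed.

Lemma profile_slack_ge0 f N s x : profile N -> (0 <= slack f N s x)%E.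
Proof. by move=> pN; apply: slack_ge0 => ?; exact: profile_ge0. Qed.

Lemma profile_wint f g N : young_function f -> weight g -> profile N ->
  profile (wint f g N).
Proof.
move=> yf wg pN; have N0 t := profile_ge0 t pN.
have g0 x := weight_ge0 x wg; have mN := measurable_profile pN.
have mg := wg.1.
split.
- move=> s; rewrite wint_ge0//=.
  have [b [b0 hb]] := profile_slack_bound s yf pN.
  have [B gB] := wg.2.
  have -> : wint f g N s =
      (\int[mu]_(x in `[0%R, b]) ((g x)%:E * slack f N s x))%E.
    rewrite [RHS]integral_mkcond; apply: eq_integral => x _.
    rewrite patchE; case: ifPn => //; rewrite notin_setE/= in_itv/= => /negP.
    rewrite negb_and -!ltNge => /orP[x0|bx]; last by rewrite hb// mule0.
    by rewrite /slack leNgt x0 mule0.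
  apply: (@le_lt_trans _ _ (\int[mu]_(x in `[0%R, b]) (B%:E * N s))%E).
    apply: ge0_le_integral => //.
    + by move=> x _; exact: wintegrand_ge0.
    + by apply/measurable_funTS; exact: measurable_wintegrand.
    + move=> x _; apply: lee_pmul => //; rewrite ?lee_fin//.
      * exact: slack_ge0.
      * by case/andP: (gB x).
      * exact: profile_slack_le.
  rewrite integral_cst//=; apply: lte_mul_pinfty.
  + by apply: mule_ge0 => //; rewrite lee_fin; case/andP: (gB 0); apply: le_trans.
  + by rewrite fin_numM// ge0_fin_numE//; case: pN => /(_ s)/andP[].
  + by rewrite lebesgue_measure_itv/=; case: ifP => _; rewrite ?ltry.
- move=> s t st; apply: (wint_nondecreasing yf (weight_nn wg) N0 _ st).
  by case: pN.
- move=> s s0; apply: integral0_eq => x _.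
  rewrite /slack; case: ifP => _; last by rewrite mule0.
  case: pN => _ _ ->; first by rewrite mule0.
  by apply: le_lt_trans s0; rewrite gerBl fine_ge0// young_ge0.
Qed.

(** Tonelli: both orders integrate N at the level s - f1 x - f2 y. *)
Lemma wintC f1 f2 g1 g2 N s : young_function f1 -> young_function f2 ->
  nnweight g1 -> nnweight g2 -> profile N ->
  wint f1 g1 (wint f2 g2 N) s = wint f2 g2 (wint f1 g1 N) s.
Proof.
move=> yf1 yf2 wg1 wg2 pN.
have N0 t := profile_ge0 t pN; have mN := measurable_profile pN.
have expand f g f' g' x : young_function f' -> nnweight g -> nnweight g' ->
    ((g x)%:E * slack f (wint f' g' N) s x =
     \int[mu]_y ((g x)%:E * (g' y)%:E *
       slack f (fun r => slack f' N r y) s x))%E.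
  move=> yf' wg wg'; rewrite /slack; case: ifP => dx; last first.
    by rewrite mule0 integral0_eq// => y _; rewrite mule0.
  rewrite -/(slack _ _ _ _) /wint -ge0_integralZl//.
  - by apply: eq_integral => y _; rewrite muleA.
  - exact: measurable_wintegrand yf' wg'.1 mN.
  - by move=> y _; apply: wintegrand_ge0 => // ?; exact: wg'.2.
  - by rewrite lee_fin; exact: wg.2.
rewrite {1}/wint; under eq_integral do rewrite expand//.
rewrite [RHS]/wint; under [RHS]eq_integral do rewrite expand//.
pose F (p : R * R) := ((g1 p.1)%:E * (g2 p.2)%:E *
       slack f1 (fun r => slack f2 N r p.2) s p.1)%E.
rewrite (fubini_tonelli (m1 := mu) (m2 := mu) F).
- apply: eq_integral => y _; apply: eq_integral => x _; rewrite /F/=.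
  rewrite [((g2 y)%:E * _)%E]muleC; congr (_ * _)%E.
  by rewrite /slack; do 2 case: ifP => // _; rewrite addrAC.
- apply: emeasurable_funM.
    apply: emeasurable_funM; apply/measurable_EFinP.
      exact: (measurableT_comp wg1.1).
    exact: (measurableT_comp wg2.1).
  apply: measurable_fun_ifT => //; first exact: measurable_dom.
  apply: measurable_slack => //; apply: measurable_funB => //.
  apply: measurableT_comp; first exact: fine_measurable.
  exact: (measurableT_comp (measurable_young yf1)).
- move=> p; apply: mule_ge0.
    by apply: mule_ge0; rewrite lee_fin; [exact: wg1.2|exact: wg2.2].
  by apply: slack_ge0 => ?; exact: slack_ge0.
Qed.

Lemma profile_iwint n (f : 'I_n -> _) (g : 'I_n -> _) N :
  (forall i, young_function (f i)) -> (forall i, weight (g i)) ->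
  profile N -> profile (iwint f g N).
Proof.
elim: n f g => [|n IH] f g yf wg pN //=.
by apply: profile_wint => //; apply: IH.
Qed.

Lemma iwint_nondecreasing n (f : 'I_n -> _) (g : 'I_n -> _) N :
  (forall i, young_function (f i)) -> (forall i, nnweight (g i)) ->
  (forall s, 0 <= N s)%E -> (forall s t : R, s <= t -> (N s <= N t)%E) ->
  (forall s, 0 <= iwint f g N s)%E /\
  (forall s t : R, s <= t -> (iwint f g N s <= iwint f g N t)%E).
Proof.
elim: n f g => [|n IH] f g yf wg N0 ndN //=.
have [I0 ndI] := IH (fun i => f (lift ord0 i)) (fun i => g (lift ord0 i))
  (fun=> yf _) (fun=> wg _) N0 ndN.
split=> [s|s t st]; last exact: wint_nondecreasing.
by apply: wint_ge0 => // x; exact: (wg ord0).2.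
Qed.

Lemma eq_wint f g g' N N' s : (forall x, 0 <= x -> g x = g' x) -> N =1 N' ->
  wint f g N s = wint f g' N' s.
Proof.
move=> gg NN; apply: eq_integral => x _; rewrite /slack.
by case: ifP => [/andP[x0 _]|]; rewrite ?mule0// gg// NN.
Qed.

Lemma eq_iwint n (f : 'I_n -> _) (g g' : 'I_n -> _) N N' s :
  (forall i x, 0 <= x -> g i x = g' i x) -> N =1 N' ->
  iwint f g N s = iwint f g' N' s.
Proof.
elim: n f g g' s => [|n IH] f g g' s gg NN /=; first exact: NN.
apply: eq_wint => [|r]; first exact: gg.
by apply: IH => // i; exact: gg.
Qed.

(** Turns a coordinate in front into a modification of the base profile, the form in which induction
    hypotheses can absorb it. *)
Lemma wint_iwintC n (f : 'I_n -> _) (g : 'I_n -> _) f0 g0 N s :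
  (forall i, young_function (f i)) -> (forall i, weight (g i)) ->
  young_function f0 -> weight g0 -> profile N ->
  wint f0 g0 (iwint f g N) s = iwint f g (wint f0 g0 N) s.
Proof.
elim: n f g s => [|n IH] f g s yf wg yf0 wg0 pN //=.
rewrite wintC//; [|exact: weight_nn|exact: weight_nn|exact: profile_iwint].
by apply: eq_wint => // r; rewrite IH.
Qed.

End slices.

(** * Total positivity and Chebyshev's integral inequality *)

Section ratio.
Context {R : realType}.
Local Notation mu := (@lebesgue_measure R).
Implicit Types (x y : R) (f : R -> \bar R) (g : R -> R) (N : R -> \bar R).

(** Stated through exponential minorants of the values: no logarithm of 0 or of an infinite value
    occurs, and zeros of N make the condition vacuous. *)
Definition logconcave N : Prop := forall u v a b th : R, 0 <= th <= 1 ->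
  ((expR a)%:E <= N u)%E -> ((expR b)%:E <= N v)%E ->
  ((expR ((1 - th) * a + th * b))%:E <= N ((1 - th) * u + th * v)%R)%E.

Definition rel_dir (b : bool) (x y : R) := if b then x <= y else y <= x.

(* A / C is monotone, nondecreasing if b and nonincreasing otherwise;
   cross-multiplied since C may vanish. *)
Definition rmono (b : bool) (A C : R -> \bar R) : Prop :=
  forall s t, rel_dir b s t -> (A s * C t <= A t * C s)%E.

Lemma rel_dir_total b x y : rel_dir b x y \/ rel_dir b y x.
Proof. by case: b; apply/orP; exact: le_total. Qed.

(** The points b and c lie between a and d and have the same sum, so their weights as convex
    combinations of a and d are th, 1 - th and the reverse; the two log-concavity bounds multiply to
    N a N d. *)
Lemma logconcave_swap N a b c d : profile N -> logconcave N ->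
  a <= b -> b <= d -> b + c = a + d -> (N a * N d <= N b * N c)%E.
Proof.
move=> pN lN ab bd e; have N0 s := profile_ge0 s pN.
have Nfin s : (N s < +oo)%E by case: pN => /(_ s)/andP[].
have -> : c = a + d - b by rewrite -e; ring.
have [ad|da] := ltP a d; last first.
  have -> : b = a by lra.
  have -> : d = a by lra.
  by rewrite addrK.
case: (eqVneq (N a) 0%E) => [->|Na0]; first by rewrite mul0e mule_ge0.
have Nap : (0 < N a)%E by rewrite lt_neqAle eq_sym Na0 N0.
have Ndp : (0 < N d)%E.
  by apply: (lt_le_trans Nap); case: pN => _ + _; apply; rewrite ltW.
have toexp s : (0 < N s)%E -> exists al, N s = (expR al)%:E.
  move: (Nfin s); case: (N s) => [r| |]// _; rewrite lte_fin => r0.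
  by exists (ln r); rewrite lnK.
have [al Ea] := toexp _ Nap; have [de Ed] := toexp _ Ndp.
pose th := (b - a) / (d - a).
have th01 : 0 <= th <= 1.
  rewrite /th ler_pdivrMr ?subr_gt0// mul1r lerD2r bd andbT.
  by rewrite divr_ge0 ?subr_ge0// ltW.
have th01' : 0 <= 1 - th <= 1 by move: th01; lra.
have h1 := lN a d al de th th01; rewrite Ea Ed in h1.
have h2 := lN a d al de _ th01'; rewrite Ea Ed in h2.
have {}h1 := h1 (lexx _) (lexx _); have {}h2 := h2 (lexx _) (lexx _).
have E1 : (1 - th) * a + th * d = b by rewrite /th; field; lra.
have E2 : (1 - (1 - th)) * a + (1 - th) * d = a + d - b by rewrite -E1; ring.
rewrite E1 in h1; rewrite E2 in h2.
rewrite Ea Ed; apply: (le_trans _ (lee_pmul _ _ h1 h2)).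
- by rewrite -!EFinM -!expRD lee_fin ler_expR; lra.
- by rewrite lee_fin expR_ge0.
- by rewrite lee_fin expR_ge0.
Qed.

(** Total positivity of order 2 of the kernel N (s - f x): of the four levels, s - f y is the lowest
    and t - f x the highest, and both pairs have the same sum. *)
Lemma slack_swap f N s t x y : young_function f -> profile N ->
  logconcave N -> s <= t -> x <= y ->
  (slack f N s y * slack f N t x <= slack f N t y * slack f N s x)%E.
Proof.
move=> yf pN lN st xy; have N0 s := profile_ge0 s pN.
have [x0|x0] := ltP x 0.
  have hx r : slack f N r x = 0%E by rewrite /slack leNgt x0.
  by rewrite !hx !mule0.
have y0 := le_trans x0 xy.
rewrite /slack x0 y0/=; case: ifPn => fy; last by rewrite !mul0e.
have fxy : (f `|x|%R <= f `|y|%R)%E.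
  by apply: young_norm_le => //; rewrite !ger0_norm.
rewrite (le_lt_trans fxy fy).
have fyf : f `|y|%R \is a fin_num by rewrite ge0_fin_numE ?young_ge0.
have fxf : f `|x|%R \is a fin_num.
  by rewrite ge0_fin_numE ?young_ge0//; exact: le_lt_trans fy.
have fxy' := fine_le fxf fyf fxy.
by apply: logconcave_swap => //; lra.
Qed.

(** The coefficients are extended reals because integrals, possibly infinite, take their place when
    the second variable is integrated. *)
Lemma le_integral_comb (p1 q1 p2 q2 : R -> \bar R) (a1 b1 a2 b2 : \bar R) :
  measurable_fun setT p1 -> measurable_fun setT q1 ->
  measurable_fun setT p2 -> measurable_fun setT q2 ->
  (forall x, 0 <= p1 x)%E -> (forall x, 0 <= q1 x)%E ->
  (forall x, 0 <= p2 x)%E -> (forall x, 0 <= q2 x)%E ->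
  (0 <= a1)%E -> (0 <= b1)%E -> (0 <= a2)%E -> (0 <= b2)%E ->
  (forall x, p1 x * a1 + q1 x * b1 <= p2 x * a2 + q2 x * b2)%E ->
  ((\int[mu]_x p1 x) * a1 + (\int[mu]_x q1 x) * b1 <=
   (\int[mu]_x p2 x) * a2 + (\int[mu]_x q2 x) * b2)%E.
Proof.
move=> mp1 mq1 mp2 mq2 p10 q10 p20 q20 a10 b10 a20 b20 H.
have mZ (p : R -> \bar R) a : measurable_fun setT p ->
    measurable_fun setT (fun x => p x * a)%E.
  by move=> mp; exact: emeasurable_funM.
rewrite -!ge0_integralZr// -!ge0_integralD//; try (by exact: mZ);
  try by move=> x _; exact: mule_ge0.
apply: ge0_le_integral => //.
- by move=> x _; rewrite adde_ge0// mule_ge0.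
- by apply: emeasurable_funD; exact: mZ.
- by apply: emeasurable_funD; exact: mZ.
Qed.

(** Integrating the symmetrised pointwise inequality in x and then in y yields each side twice. *)
Lemma integral_chebyshev (h : R -> R) (u v : R -> \bar R) :
  measurable_fun setT h -> measurable_fun setT u -> measurable_fun setT v ->
  (forall x, 0 <= h x) -> (forall x, (0 <= u x)%E) -> (forall x, (0 <= v x)%E) ->
  (forall x y, ((h x)%:E * v x * u y + (h y)%:E * v y * u x <=
                (h x)%:E * u x * v y + (h y)%:E * u y * v x)%E) ->
  ((\int[mu]_x ((h x)%:E * v x)) * (\int[mu]_x u x) <=
   (\int[mu]_x ((h x)%:E * u x)) * (\int[mu]_x v x))%E.
Proof.
move=> mh mu_ mv h0 u0 v0 H.
have mhE : measurable_fun setT (EFin \o h) by exact/measurable_EFinP.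
have mhu := emeasurable_funM mhE mu_; have mhv := emeasurable_funM mhE mv.
have hu0 x : (0 <= (h x)%:E * u x)%E by rewrite mule_ge0 ?lee_fin.
have hv0 x : (0 <= (h x)%:E * v x)%E by rewrite mule_ge0 ?lee_fin.
set A := (\int[mu]_x ((h x)%:E * v x))%E; set U := (\int[mu]_x u x)%E.
set B := (\int[mu]_x ((h x)%:E * u x))%E; set V := (\int[mu]_x v x)%E.
have U0 : (0 <= U)%E by exact: integral_ge0.
have V0 : (0 <= V)%E by exact: integral_ge0.
have A0 : (0 <= A)%E by exact: integral_ge0.
have B0 : (0 <= B)%E by exact: integral_ge0.
have inner y : (A * u y + U * ((h y)%:E * v y) <=
                B * v y + V * ((h y)%:E * u y))%E.
  apply: le_integral_comb => //; rewrite ?mule_ge0 ?lee_fin// => x.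
  by rewrite [(u x * _)%E]muleC [(v x * _)%E]muleC; exact: H.
have : (U * A + A * U <= V * B + B * V)%E.
  apply: le_integral_comb => //; rewrite ?mule_ge0 ?lee_fin// => y.
  rewrite [(_ * U)%E]muleC [(u y * A)%E]muleC.
  by rewrite [(v y * B)%E]muleC [(_ * V)%E]muleC.
rewrite [(U * A)%E]muleC [(V * B)%E]muleC.
have : (0 <= A * U)%E by exact: mule_ge0.
have : (0 <= B * V)%E by exact: mule_ge0.
case: (A * U)%E => [r| |]//; case: (B * V)%E => [q| |]//; rewrite ?leey//.
by rewrite -!EFinD !lee_fin; lra.
Qed.

End ratio.

(** * Preservation of log-concavity *)

Section prekopa.
Context {R : realType}.
Local Notation mu := (@lebesgue_measure R).
Implicit Types (x y : R) (f : R -> \bar R) (g : R -> R) (N : R -> \bar R).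

(* Only the part in [0, +oo[ matters; it has to contain its left endpoint, at
   which N (s - f x) is then maximal. *)
Definition segment (J : set R) : Prop :=
  is_interval J /\
  forall x, J x -> 0 <= x ->
    exists a, [/\ J a, 0 <= a & forall y, J y -> 0 <= y -> a <= y].

Lemma weight_indic (J : set R) : measurable J -> weight (\1_J : R -> R).
Proof.
move=> mJ; split; first exact: measurable_indic.
by exists 1 => x; rewrite indicE; case: (_ \in _); rewrite ?lexx ?ler01.
Qed.

Lemma segment_measurable J : segment J -> measurable J.
Proof. by case=> iJ _; exact: is_interval_measurable. Qed.

Lemma integral_level (c : R) (y : \bar R) : 0 < c -> (0 <= y)%E ->
  (c%:E * \int[mu]_t (if [&& (0 < t)%R, (t <= 1)%R & (c * t)%:E <= y]
     then 1 else 0) =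
   mine c%:E y)%E.
Proof.
move=> c0 y0.
have E (m : R) : 0 <= m ->
    (forall t, [&& 0 < t, t <= 1 & ((c * t)%:E <= y)%E] = (t \in `]0, m])) ->
    (\int[mu]_t (if [&& (0 < t)%R, (t <= 1)%R & (c * t)%:E <= y] then 1 else 0)
     = m%:E)%E.
  move=> m0 H; under eq_integral do rewrite H.
  rewrite (_ : (fun _ => _) = (fun t => (\1_`]0, m] t)%:E)); last first.
    by apply/funext => t; rewrite indicE mem_setE; case: ifP.
  rewrite integral_indic// setIT/=. rewrite lebesgue_measure_itv/= lte_fin.
  by move: m0; rewrite le_eqVlt => /predU1P[<-|->]; rewrite ?ltxx// sube0.
case: y y0 E => [r| |]// r0 E; last first.
  rewrite (E 1)// ?mule1 ?miney// => t.
  by rewrite leey andbT in_itv.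
rewrite lee_fin in r0; rewrite (E (Num.min 1 (r / c))).
- by rewrite -EFinM -EFin_min minr_pMr ?(ltW c0)// mulr1 mulrCA divff ?gt_eqF// mulr1.
- by rewrite le_min ler01 divr_ge0// ltW.
- by move=> t; rewrite in_itv/= le_min lee_fin ler_pdivlMr// [t * c]mulrC.
Qed.

(** Layer-cake formula in relative heights t in ]0, 1], so that functions with different maxima can
    be compared at equal t. The minimum with c allows c to lie below the maximum. *)
Lemma integral_layers (G : R -> \bar R) (c : R) : 0 < c ->
  measurable_fun setT G -> (forall x, 0 <= G x)%E ->
  measurable_fun setT (fun t : R => if (0 < t <= 1)%R
      then mu [set x | (c * t)%:E <= G x]%E else 0%E) /\
  (c%:E * \int[mu]_t (if (0 < t <= 1)%R
      then mu [set x | (c * t)%:E <= G x] else 0) =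
   \int[mu]_x mine c%:E (G x))%E.
Proof.
move=> c0 mG G0.
pose F (p : R * R) : \bar R :=
  if [&& 0 < p.2, p.2 <= 1 & ((c * p.2)%:E <= G p.1)%E] then 1%E else 0%E.
have F0 p : (0 <= F p)%E by rewrite /F; case: ifP.
have mF : measurable_fun setT F.
  apply: measurable_fun_ifT => //.
  apply: measurable_and; first exact: measurable_fun_ltr.
  apply: measurable_and; first exact: measurable_fun_ler.
  apply: measurable_fun_lee; last exact: (measurableT_comp mG).
  by apply/measurable_EFinP; exact: measurable_funM.
have FE t : (\int[mu]_x F (x, t) = if (0 < t <= 1)%R
    then mu [set x | (c * t)%:E <= G x]%E else 0)%E.
  rewrite /F/=; case: ifPn => [/andP[-> ->]/=|t01].
    rewrite (_ : (fun _ => _) =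
      (fun x => (\1_[set x | (c * t)%:E <= G x]%E x)%:E)); last first.
      apply/funext => x; rewrite indicE; case: ifPn => Gx; first by rewrite mem_set.
      by rewrite memNset//=; exact/negP.
    rewrite integral_indic ?setIT// -[X in measurable X]setTI.
    exact: emeasurable_fun_c_infty.
  by apply: integral0_eq => x _; rewrite andbA (negbTE t01).
split.
  rewrite (_ : (fun _ => _) = fun t => \int[mu]_x F (x, t))%E; last first.
    by apply/funext => t; rewrite FE.
  exact: (measurable_fun_fubini_tonelli_G (m1 := mu) F).
under eq_integral do rewrite -FE.
rewrite -(fubini_tonelli (m1 := mu) (m2 := mu) F)// -ge0_integralZl//.
- by apply: eq_integral => x _; rewrite /F/= integral_level.
- exact: (measurable_fun_fubini_tonelli_F (m2 := mu) F).
- by move=> x _; exact: integral_ge0.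
- by rewrite lee_fin ltW.
Qed.

Lemma integral_superadditive (p q r : R -> \bar R) (a b : R) :
  measurable_fun setT p -> measurable_fun setT q -> measurable_fun setT r ->
  (forall x, 0 <= p x)%E -> (forall x, 0 <= q x)%E -> 0 <= a -> 0 <= b ->
  (forall x, a%:E * p x + b%:E * q x <= r x)%E ->
  (a%:E * (\int[mu]_x p x) + b%:E * (\int[mu]_x q x) <= \int[mu]_x r x)%E.
Proof.
move=> mp mq mr p0 q0 a0 b0 H.
have ap0 x : (0 <= a%:E * p x)%E by rewrite mule_ge0 ?lee_fin.
have bq0 x : (0 <= b%:E * q x)%E by rewrite mule_ge0 ?lee_fin.
have map : measurable_fun setT (fun x => a%:E * p x)%E by exact: emeasurable_funM.
have mbq : measurable_fun setT (fun x => b%:E * q x)%E by exact: emeasurable_funM.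
rewrite -!ge0_integralZl_EFin// -ge0_integralD//.
apply: ge0_le_integral => //; last exact: emeasurable_funD.
by move=> x _; exact: adde_ge0.
Qed.

(** The tangent line of the exponential at the convex combination lies below the graph at both
    ends. *)
Lemma expR_convex (a b th : R) : 0 <= th <= 1 ->
  expR ((1 - th) * a + th * b) <= (1 - th) * expR a + th * expR b.
Proof.
move=> /andP[t0 t1]; set w := _ + _.
have H z : expR w * (1 + (z - w)) <= expR z.
  have -> : expR z = expR w * expR (z - w) by rewrite -expRD subrKC.
  by rewrite ler_pM2l ?expR_gt0// expR_ge1Dx.
have s0 : 0 <= 1 - th by rewrite subr_ge0.
apply: le_trans (lerD (ler_wpM2l s0 (H a)) (ler_wpM2l t0 (H b))).
by rewrite le_eqVlt; apply/orP; left; apply/eqP; rewrite /w; ring.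
Qed.

(* One-dimensional Brunn-Minkowski: the level sets are intervals with the common
   left endpoint [a0], so that their lengths can be added directly. *)
Lemma level_brunn_minkowski f N J a0 (u v al be th : R) :
  young_function f -> segment J -> profile N -> logconcave N ->
  J a0 -> 0 <= a0 -> (forall y, J y -> 0 <= y -> a0 <= y) -> 0 <= th <= 1 ->
  let G s x := ((\1_J x)%:E * slack f N s x)%E in
  ((expR al)%:E <= G u a0)%E -> ((expR be)%:E <= G v a0)%E ->
  ((1 - th)%:E * mu [set x | (expR al)%:E <= G u x] +
   th%:E * mu [set x | (expR be)%:E <= G v x] <=
   mu [set x | (expR ((1 - th) * al + th * be))%:E <=
               G ((1 - th) * u + th * v)%R x])%E.
Proof.
move=> yf sJ pN lN Ja0 a00 a0min th01 G.
have mG s : measurable_fun setT (G s).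
  apply: measurable_wintegrand => //; last exact: measurable_profile.
  by apply: measurable_indic; exact: segment_measurable.
have mS c s : measurable [set x | (c%:E <= G s x)%E].
  by rewrite -[X in measurable X]setTI; exact: emeasurable_fun_c_infty.
have GP s c x : ((expR c)%:E <= G s x)%E ->
    [/\ J x, 0 <= x, f `|x|%R \is a fin_num &
        ((expR c)%:E <= N (s - fine (f `|x|))%R)%E].
  rewrite /G indicE; case: (boolP (x \in J)) => [/set_mem Jx|_]; last first.
    by rewrite mul0e lee_fin leNgt expR_gt0.
  rewrite mul1e /slack; case: ifPn => [/andP[x0 fx]|_]; last first.
    by rewrite lee_fin leNgt expR_gt0.
  by move=> H; split; rewrite // ge0_fin_numE ?young_ge0.
have GI s c x : J x -> 0 <= x -> (f `|x|%R < +oo)%E ->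
    (c%:E <= N (s - fine (f `|x|))%R -> c%:E <= G s x)%E.
  move=> Jx x0 fx; rewrite /G indicE mem_set// mul1e /slack.
  by rewrite x0 fx.
set S1 := [set x | (expR al)%:E <= G u x]%E.
set S2 := [set x | (expR be)%:E <= G v x]%E.
set S3 := [set x | _]; move=> /= Ga Gb.
have supS s c (S := [set x | (expR c)%:E <= G s x]%E) : S a0 ->
    [/\ has_sup S, (mu S <= (sup S - a0)%:E)%E & a0 <= sup S].
  move=> Sa0; have [b [b0 hb]] := profile_slack_bound s yf pN.
  have ubS : has_ubound S.
    exists b => x /= Sx; rewrite leNgt; apply/negP => bx.
    by move: Sx; rewrite /S/= /G hb// mule0 lee_fin leNgt expR_gt0.
  have hS : has_sup S by split=> //; exists a0.
  split=> //; last exact: ub_le_sup.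
  apply: (@le_trans _ _ (mu `[a0, sup S])).
    apply: le_measure; rewrite ?inE//; first exact: mS.
    move=> x /= Sx; rewrite in_itv/= ub_le_sup// andbT.
    by have [Jx x0 _ _] := GP _ _ _ Sx; exact: a0min.
  rewrite lebesgue_measure_itv/= lte_fin; case: ifPn => // _.
  by rewrite lee_fin subr_ge0 ub_le_sup.
have [hS1 m1 l1] := supS _ _ Ga; have [hS2 m2 l2] := supS _ _ Gb.
case/andP: (th01) => t0 t1; have t0' : 0 <= 1 - th by rewrite subr_ge0.
set r := (1 - th) * sup S1 + th * sup S2.
have a0r : a0 <= r.
  have := ler_wpM2l t0' l1; have := ler_wpM2l t0 l2; rewrite /r; lra.
apply: (@le_trans _ _ (r - a0)%:E).
  have -> : r - a0 = (1 - th) * (sup S1 - a0) + th * (sup S2 - a0).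
    by rewrite /r; ring.
  by rewrite [leRHS]EFinD !EFinM; apply: leeD; apply: lee_wpmul2l; rewrite ?lee_fin.
(* Open at [r], because the suprema need not be attained. *)
apply: (@le_trans _ _ (mu `[a0, r[)).
  rewrite lebesgue_measure_itv/= lte_fin; case: ifPn => // r0.
  by rewrite lee_fin subr_le0 leNgt.
apply: le_measure; rewrite ?inE//; first exact: mS.
move=> z /=; rewrite in_itv/= => /andP[a0z zr].
(* Points of the two level sets within r - z of their suprema have a convex combination [m] >= z; f
   is nondecreasing, so the bound on f m passes to f z. *)
have e0 : 0 < r - z by rewrite subr_gt0.
have [x Sx hx] := sup_adherent e0 hS1; have [y Sy hy] := sup_adherent e0 hS2.
have [Jx x0 fx Nx] := GP _ _ _ Sx; have [Jy y0 fy Ny] := GP _ _ _ Sy.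
set m := (1 - th) * x + th * y.
have zm : z <= m.
  have := ler_wpM2l t0' (ltW hx); have := ler_wpM2l t0 (ltW hy).
  rewrite /m; move: (erefl r); rewrite {2}/r; lra.
have z0 := le_trans a00 a0z; have m0 := le_trans z0 zm.
have Jz : J z.
  have [xy|yx] := leP x y; [apply: (sJ.1 a0 y)|apply: (sJ.1 a0 x)] => //.
    rewrite a0z/= (le_trans zm)//.
    have := ler_wpM2l t0' xy; rewrite /m; lra.
  rewrite a0z/= (le_trans zm)//.
  have := ler_wpM2l t0 (ltW yx); rewrite /m; lra.
have fmle : (f `|m|%R <= ((1 - th) * fine (f `|x|%R) + th * fine (f `|y|%R))%:E)%E.
  rewrite EFinD !EFinM !fineK// !ger0_norm//.
  have := yf; case => _ fc _ _ _; have := fc x y (1 - th) x0 y0.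
  by rewrite /m subKr; apply; rewrite t0' /=; lra.
have fzm : (f `|z|%R <= f `|m|%R)%E by apply: young_norm_le; rewrite // !ger0_norm.
have fz : (f `|z|%R < +oo)%E.
  by apply: le_lt_trans fzm _; apply: le_lt_trans fmle _; rewrite ltry.
apply: GI => //.
have := lN _ _ _ _ _ th01 Nx Ny; move=> /le_trans; apply.
case: pN => _ + _; apply.
have : fine (f `|z|%R) <= (1 - th) * fine (f `|x|%R) + th * fine (f `|y|%R).
  rewrite -lee_fin fineK ?ge0_fin_numE ?young_ge0//.
  exact: le_trans fzm _.
by lra.
Qed.

(** Each slice is divided by its maximum, attained at the left endpoint. Layers at equal relative
    height then satisfy the linear Brunn-Minkowski bound, which integrates to an arithmetic mean of
    normalised integrals; convexity of exp turns it into the geometric mean. *)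
Lemma logconcave_wint f N J :
  young_function f -> segment J -> profile N -> logconcave N ->
  logconcave (wint f \1_J N).
Proof.
move=> yf sJ pN lN u v a b th th01 Iu Iv.
pose G s x := ((\1_J x)%:E * slack f N s x)%E.
have mG s : measurable_fun setT (G s).
  apply: measurable_wintegrand => //; last exact: measurable_profile.
  by apply: measurable_indic; exact: segment_measurable.
have G0 s x : (0 <= G s x)%E.
  by apply: mule_ge0; [rewrite lee_fin indicE|exact: profile_slack_ge0].
have [[x0 [Jx0 x00]]|noJ] := pselect (exists x, J x /\ 0 <= x); last first.
  exfalso; move: Iu; rewrite /wint integral0_eq.
    by rewrite lee_fin leNgt expR_gt0.
  move=> x _; rewrite indicE /slack; case: (boolP (x \in J)) => [/set_mem Jx|_].
    by rewrite leNgt; case: ltP => //= x0'; [rewrite mule0|exfalso; apply: noJ; exists x].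
  by rewrite mul0e.
have [a0 [Ja0 a00 a0min]] := sJ.2 _ Jx0 x00.
have Gmax s x : (G s x <= G s a0)%E.
  rewrite /G !indicE (mem_set Ja0) mul1e.
  case: (boolP (x \in J)) => [/set_mem Jx|_]; last first.
    by rewrite mul0e; exact: profile_slack_ge0.
  rewrite mul1e {1}/slack; case: ifPn => [/andP[x0' fx]|_]; last exact: profile_slack_ge0.
  have fa : (f `|a0|%R <= f `|x|%R)%E.
    by apply: young_norm_le => //; rewrite !ger0_norm//; exact: a0min.
  rewrite /slack a00 (le_lt_trans fa fx)/=.
  case: pN => _ + _; apply; rewrite lerB// fine_le// ge0_fin_numE ?young_ge0//.
  exact: le_lt_trans fx.
have Gfin s x : (G s x < +oo)%E.
  rewrite /G indicE; apply: le_lt_trans (profile_slack_lty s x yf pN).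
  by case: (_ \in _); rewrite ?mul1e// mul0e; exact: profile_slack_ge0.
have top s c : ((expR c)%:E <= wint f \1_J N s)%E ->
    exists A, G s a0 = (expR A)%:E.
  move=> H; have : (0 < G s a0)%E.
    rewrite lt_neqAle G0 andbT; apply/negP => /eqP Gs.
    move: H; rewrite /wint integral0_eq; first by rewrite lee_fin leNgt expR_gt0.
    by move=> x _; apply/eqP; rewrite eq_le G0 andbT Gs Gmax.
  move: (Gfin s a0); case: (G s a0) => [r| |]// _; rewrite lte_fin => r0.
  by exists (ln r); rewrite lnK.
have [A EA] := top _ _ Iu; have [B EB] := top _ _ Iv.
(* The slice at level [w] is compared with expR C, the weighted geometric mean of the two maxima;
   whatever exceeds this height is discarded by [mine]. *)
set w := (1 - th) * u + th * v; pose C := (1 - th) * A + th * B.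
have [mA hA] := integral_layers (expR_gt0 A) (mG u) (G0 u).
have [mB hB] := integral_layers (expR_gt0 B) (mG v) (G0 v).
have [mC hC] := integral_layers (expR_gt0 C) (mG w) (G0 w).
set LA := (fun t : R => _) in mA; set LB := (fun t : R => _) in mB.
set LC := (fun t : R => _) in mC.
rewrite -/LA in hA; rewrite -/LB in hB; rewrite -/LC in hC.
have LA0 t : (0 <= LA t)%E by rewrite /LA; case: ifP.
have LB0 t : (0 <= LB t)%E by rewrite /LB; case: ifP.
have LC0 t : (0 <= LC t)%E by rewrite /LC; case: ifP.
case/andP: (th01) => t0 t1; have t0' : 0 <= 1 - th by rewrite subr_ge0.
have key : ((1 - th)%:E * (\int[mu]_t LA t) + th%:E * (\int[mu]_t LB t) <=
            \int[mu]_t LC t)%E.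
  apply: (integral_superadditive mA mB mC LA0 LB0 t0' t0).
  move=> t; rewrite /LA /LB /LC; case: ifPn => [/andP[tt0 tt1]|_]; last first.
    by rewrite !mule0 adde0.
  have ltE X : expR X * t = expR (X + ln t) by rewrite expRD lnK.
  rewrite !ltE.
  have -> : C + ln t = (1 - th) * (A + ln t) + th * (B + ln t) by rewrite /C; ring.
  apply: (level_brunn_minkowski (a0 := a0)) => //.
  - by rewrite -ltE -/(G _ _) EA lee_fin ler_piMr ?expR_ge0.
  - by rewrite -ltE -/(G _ _) EB lee_fin ler_piMr ?expR_ge0.
clearbody LA LB LC.
have PA0 : (0 <= \int[mu]_t LA t)%E by exact: integral_ge0.
have PB0 : (0 <= \int[mu]_t LB t)%E by exact: integral_ge0.
move: (\int[mu]_t LA t)%E (\int[mu]_t LB t)%E (\int[mu]_t LC t)%E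
  hA hB hC key PA0 PB0 => PA PB PC hA hB hC key PA0 PB0.
have IA : ((expR (a - A))%:E <= PA)%E.
  rewrite -(lee_pmul2l (x := (expR A)%:E))// ?lte_fin ?expR_gt0// hA -EFinM.
  rewrite -expRD subrKC; apply: le_trans Iu _; rewrite /wint.
  under [leRHS]eq_integral do rewrite min_r -?EA//; exact: lexx.
have IB : ((expR (b - B))%:E <= PB)%E.
  rewrite -(lee_pmul2l (x := (expR B)%:E))// ?lte_fin ?expR_gt0// hB -EFinM.
  rewrite -expRD subrKC; apply: le_trans Iv _; rewrite /wint.
  under [leRHS]eq_integral do rewrite min_r -?EB//; exact: lexx.
apply: (@le_trans _ _ (\int[mu]_x mine (expR C)%:E (G w x))%E); last first.
  apply: ge0_le_integral => //.
  - by move=> x _; rewrite le_min lee_fin expR_ge0 G0.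
  - by apply: measurable_mine; [exact: measurable_cst|exact: mG].
  - exact: mG.
  - by move=> x _; rewrite ge_min lexx orbT.
rewrite -hC.
have -> : (1 - th) * a + th * b = C + ((1 - th) * (a - A) + th * (b - B)).
  by rewrite /C; ring.
rewrite expRD EFinM; apply: lee_wpmul2l; first by rewrite lee_fin expR_ge0.
apply: le_trans key.
apply: (@le_trans _ _ ((1 - th)%:E * (expR (a - A))%:E + th%:E * (expR (b - B))%:E)%E).
  by rewrite -!EFinM -EFinD lee_fin; exact: expR_convex.
by apply: leeD; apply: lee_wpmul2l; rewrite ?lee_fin.
Qed.

Lemma segmentT : segment setT.
Proof. by split=> // x _ _; exists 0; split. Qed.

Lemma logconcave_wint1 f N : young_function f -> profile N -> logconcave N ->
  logconcave (wint f (fun=> 1) N).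
Proof.
move=> yf pN lN; have := logconcave_wint yf segmentT pN lN.
by rewrite (_ : \1_setT = fun=> 1)//; apply/funext => x; rewrite indicT.
Qed.

End prekopa.

(** * Negative orthant dependence *)

Section negative_dependence.
Context {R : realType}.
Local Notation mu := (@lebesgue_measure R).
Implicit Types (x y : R) (f : R -> \bar R) (g : R -> R) (N : R -> \bar R).

Definition dirmono (b : bool) g : Prop :=
  forall x y, 0 <= x -> 0 <= y -> rel_dir b x y -> g x <= g y.

Definition dirsegment (b : bool) (J : set R) : Prop :=
  segment J /\ dirmono b \1_J.

(** The condition 0 < t empties the layers at nonpositive heights, so that for g x >= 0 the integral
    of the indicators over all t is g x. *)
Definition layer g (t : R) : set R := [set x | 0 < t /\ t <= g x].

Definition layered (b : bool) g : Prop := forall t, dirsegment b (layer g t).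

Lemma layered_mono b g : (forall x, 0 <= g x) -> layered b g -> dirmono b g.
Proof.
move=> g0 lg x y x0 y0 xy; have := g0 x; rewrite le_eqVlt => /predU1P[<-//|gx].
have := (lg (g x)).2 x y x0 y0 xy; rewrite !indicE mem_set//=.
case: (boolP (y \in _)) => [/set_mem[]//|_].
by rewrite lern0.
Qed.

Lemma weight1 : weight (fun=> 1 : R).
Proof. by split=> //; exists 1 => x; rewrite ler01 lexx. Qed.

(** On the half-line g and u / v vary in the same direction, so (g y - g x) (u y v x - v y u x) >=
    0. *)
Lemma wint_chebyshev b g (u v : R -> \bar R) : measurable_fun setT g ->
  (forall x, 0 <= g x) -> dirmono b g ->
  measurable_fun setT u -> measurable_fun setT v ->
  (forall x, 0 <= u x < +oo)%E -> (forall x, 0 <= v x < +oo)%E ->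
  (forall x, x < 0 -> u x = 0%E) -> (forall x, x < 0 -> v x = 0%E) ->
  (forall x y, 0 <= x -> 0 <= y -> rel_dir b x y ->
    (v y * u x <= v x * u y)%E) ->
  ((\int[mu]_x ((g x)%:E * v x)) * (\int[mu]_x u x) <=
   (\int[mu]_x ((g x)%:E * u x)) * (\int[mu]_x v x))%E.
Proof.
move=> mg g0 bg mu_ mv u0 v0 un vn H.
apply: integral_chebyshev => //.
- by move=> x; case/andP: (u0 x).
- by move=> x; case/andP: (v0 x).
have fin (p : R -> \bar R) x : (0 <= p x < +oo)%E -> p x = (fine (p x))%:E.
  by move=> /andP[p0 py]; rewrite fineK// ge0_fin_numE.
move=> x y; have [x0|x0] := ltP x 0; first by rewrite (un x)// (vn x)// !(mule0, mul0e).
have [y0|y0] := ltP y 0.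
  by rewrite (un y)// (vn y)// !(mule0, mul0e).
have vx := fin v x (v0 x); have vy := fin v y (v0 y).
have ux := fin u x (u0 x); have uy := fin u y (u0 y).
have key x' y' : 0 <= x' -> 0 <= y' -> rel_dir b x' y' ->
    g x' <= g y' /\
    fine (v y') * fine (u x') <= fine (v x') * fine (u y').
  move=> x'0 y'0 xy; split; first exact: bg.
  have := H _ _ x'0 y'0 xy.
  by rewrite (fin v y')// (fin u x')// (fin v x')// (fin u y')// -!EFinM lee_fin.
rewrite vx vy ux uy -!EFinM -!EFinD lee_fin.
case: (rel_dir_total b x y) => /key => [/(_ x0 y0)|/(_ y0 x0)] [h1 h2].
  have := ler_wpM2l (_ : 0 <= g y - g x) h2; rewrite subr_ge0 => /(_ h1); nra.
have := ler_wpM2l (_ : 0 <= g x - g y) h2; rewrite subr_ge0 => /(_ h1); nra.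
Qed.

Lemma wint1E f N s : wint f (fun=> 1) N s = (\int[mu]_x slack f N s x)%E.
Proof. by apply: eq_integral => x _; rewrite mul1e. Qed.

Lemma slack_neg f N s x : x < 0 -> slack f N s x = 0%E.
Proof. by move=> x0; rewrite /slack leNgt x0. Qed.

(** By [slack_swap], raising the level shifts the mass of the slice towards larger x, which moves
    the average of a monotone g in the direction of its monotonicity. *)
Lemma rmono_wint b f g N : young_function f -> weight g -> dirmono b g ->
  profile N -> logconcave N -> rmono b (wint f g N) (wint f (fun=> 1) N).
Proof.
move=> yf wg bg pN lN s t st; rewrite !wint1E.
have mN := measurable_profile pN.
apply: (wint_chebyshev wg.1 (fun x => weight_ge0 x wg) bg).
- exact: measurable_slack.
- exact: measurable_slack.
- by move=> x; rewrite profile_slack_ge0// profile_slack_lty.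
- by move=> x; rewrite profile_slack_ge0// profile_slack_lty.
- by move=> x; exact: slack_neg.
- by move=> x; exact: slack_neg.
move=> x y x0 y0; case: b {bg} st => /= st xy; first by rewrite [leRHS]muleC; exact: slack_swap.
by rewrite muleC; exact: slack_swap.
Qed.

(** A / C is the product of A / B and B / C. Where B s = 0, [A <= B] forces A s = 0; where only B t
    = 0, the second ratio forces C t = 0. *)
Lemma rmono_trans b (A B C : R -> \bar R) :
  (forall s, 0 <= A s)%E -> (forall s, A s <= B s)%E ->
  (forall s, B s < +oo)%E -> (forall s, 0 <= C s < +oo)%E ->
  rmono b A B -> rmono b B C -> rmono b A C.
Proof.
move=> A0 AB By C0 rAB rBC s t st.
have fin (p : R -> \bar R) x : (0 <= p x < +oo)%E -> p x = (fine (p x))%:E.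
  by move=> /andP[p0 py]; rewrite fineK// ge0_fin_numE.
have B0 r : (0 <= B r < +oo)%E by rewrite By (le_trans (A0 r) (AB r)).
have A0y r : (0 <= A r < +oo)%E by rewrite A0 (le_lt_trans (AB r) (By r)).
have := rAB _ _ st; have := rBC _ _ st.
have := A0 s; have := A0 t; have := AB s; have := AB t.
have := C0 s; have := C0 t.
rewrite (fin A s)// (fin A t)// (fin B s)// (fin B t)// (fin C s)// (fin C t)//.
rewrite -!EFinM !lee_fin !ltry !andbT.
move: (fine (A s)) (fine (A t)) (fine (B s)) (fine (B t)) (fine (C s)) (fine (C t)).
move=> a a' b' b'' c c' c'0 c0 ab' ab a'0 a0 h1 h2.
have [Bs0|Bs0] := ltP 0 b'; last first.
  have -> : a = 0 by lra.
  by rewrite mul0r mulr_ge0.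
have [Bt0|Bt0] := ltP 0 b''; last first.
  have E : b'' = 0 by lra.
  rewrite E mul0r in h1.
  have -> : c' = 0 by apply/eqP; rewrite eq_le c'0 andbT -(pmulr_rle0 _ Bs0).
  by rewrite mulr0 mulr_ge0.
rewrite -(ler_pM2l (mulr_gt0 Bs0 Bt0)).
have := ler_wpM2l (mulr_ge0 a0 (ltW Bt0)) h1.
have := ler_wpM2r (mulr_ge0 c0 (ltW Bt0)) h2.
nra.
Qed.

Lemma le_wint f g g' N s : young_function f -> weight g -> weight g' ->
  profile N -> (forall x, g x <= g' x) -> (wint f g N s <= wint f g' N s)%E.
Proof.
move=> yf wg wg' pN gg'; have mN := measurable_profile pN.
apply: ge0_le_integral => //.
- move=> x _; apply: wintegrand_ge0 => [t|y]; [exact: profile_ge0|exact: weight_ge0].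
- exact: measurable_wintegrand yf wg.1 mN.
- exact: measurable_wintegrand yf wg'.1 mN.
- move=> x _; apply: lee_wpmul2r; first exact: profile_slack_ge0.
  by rewrite lee_fin.
Qed.

Lemma indic_le1 (J : set R) x : \1_J x <= 1 :> R.
Proof. by rewrite indicE; case: (_ \in _). Qed.

Lemma logconcave_iwint n (f : 'I_n -> _) (J : 'I_n -> set R) N :
  (forall i, young_function (f i)) -> (forall i, segment (J i)) ->
  profile N -> logconcave N -> logconcave (iwint f (fun i => \1_(J i)) N).
Proof.
elim: n f J => [|n IH] f J yf sJ pN lN //=.
have wJ i : weight (\1_(J i) : R -> R).
  by apply: weight_indic; exact: segment_measurable.
apply: logconcave_wint => //; last by apply: IH.
by apply: profile_iwint => // i; exact: wJ.
Qed.

(** Restrictions are added one coordinate at a time; indicators of segments keep the profile of the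
    other coordinates log-concave, as [rmono_wint] requires. *)
Lemma rmono_iwint_indic b n (f : 'I_n -> _) (J : 'I_n -> set R) N :
  (forall i, young_function (f i)) -> (forall i, dirsegment b (J i)) ->
  profile N -> logconcave N ->
  rmono b (iwint f (fun i => \1_(J i)) N) (iwint f (fun i => fun=> 1) N).
Proof.
elim: n f J N => [|n IH] f J N yf sJ pN lN /=; first by move=> s t _; rewrite muleC.
have wJ i : weight (\1_(J i) : R -> R).
  by apply: weight_indic; apply: segment_measurable; exact: (sJ i).1.
have w1 := weight1.
set fs := fun i => f (lift ord0 i); set G := iwint fs _ N.
have pG : profile G by apply: profile_iwint => // i; exact: yf.
have lG : logconcave G.
  apply: logconcave_iwint => // i; first exact: yf.
  exact: (sJ _).1.
have p1 : profile (iwint fs (fun=> (fun=> 1)) N).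
  by apply: profile_iwint => // i; exact: yf.
have pG1 : profile (wint (f ord0) (fun=> 1) G) by exact: profile_wint.
(* The intermediate profile leaves coordinate 0 free and restricts all others. *)
apply: (@rmono_trans b _ (wint (f ord0) (fun=> 1) G)).
- by move=> s; apply: profile_ge0; exact: profile_wint.
- by move=> s; apply: le_wint => // x; exact: indic_le1.
- by move=> s; case: pG1 => /(_ s)/andP[].
- by move=> s; have [+ _ _] := profile_wint (yf ord0) w1 p1; exact.
- by apply: rmono_wint => //; exact: (sJ ord0).2.
have yfs i : young_function (fs i) by exact: yf.
have wJs i : weight (\1_(J (lift ord0 i)) : R -> R) by exact: wJ.
(* The free coordinate 0 joins the base profile, which stays log-concave. *)
move=> s t st; rewrite /G !wint_iwintC//.
by apply: IH => //; [exact: profile_wint|exact: logconcave_wint1].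
Qed.

Lemma layer_indicE g x : (fun t => \1_(layer g t) x : R) = \1_`]0, g x].
Proof.
apply/funext => t; rewrite !indicE.
suff -> : (x \in layer g t) = (t \in `]0, g x]%classic) by [].
apply/idP/idP => /set_mem /=.
  by move=> [t0 tg]; rewrite mem_set//= in_itv/= t0.
by rewrite in_itv/= => /andP[t0 tg]; rewrite mem_set.
Qed.

Lemma layerE g x : 0 <= g x -> ((g x)%:E = \int[mu]_t (\1_(layer g t) x)%:E)%E.
Proof.
move=> g0; rewrite (_ : (fun _ => _) = (fun t => (\1_`]0, g x] t)%:E)).
  rewrite integral_indic// setIT/= lebesgue_measure_itv/= lte_fin.
  by move: g0; rewrite le_eqVlt => /predU1P[<-|->]; rewrite ?ltxx// sube0.
by rewrite -layer_indicE.
Qed.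

Lemma wint_layers f g N : young_function f -> weight g -> profile N ->
  (forall s, measurable_fun setT (fun t => wint f \1_(layer g t) N s)) /\
  (forall s, wint f g N s = \int[mu]_t wint f \1_(layer g t) N s)%E.
Proof.
move=> yf wg pN; have mN := measurable_profile pN.
have N0 t := profile_ge0 t pN.
pose F s (p : R * R) : \bar R :=
  ((if ((0 < p.2) && (p.2 <= g p.1))%R then 1%R else 0%R)%:E * slack f N s p.1)%E.
have FE s x t : F s (x, t) = ((\1_(layer g t) x)%:E * slack f N s x)%E.
  rewrite /F/= indicE; case: ifPn => H.
    by rewrite mem_set//; exact/andP.
  by rewrite memNset//= => -[h1 h2]; rewrite h1 h2 in H.
have F0 s p : (0 <= F s p)%E.
  by apply: mule_ge0; [rewrite lee_fin; case: ifP|exact: slack_ge0].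
have mF s : measurable_fun setT (F s).
  apply: emeasurable_funM; last exact: measurable_slack.
  apply/measurable_EFinP; apply: measurable_fun_ifT => //.
  apply: measurable_and; first exact: measurable_fun_ltr.
  by apply: measurable_fun_ler => //; exact: (measurableT_comp wg.1).
split=> s.
  rewrite (_ : (fun _ => _) = fun t => \int[mu]_x F s (x, t))%E; last first.
    by apply/funext => t; rewrite /wint; under [RHS]eq_integral do rewrite FE.
  exact: (measurable_fun_fubini_tonelli_G (m1 := mu) (F s) (mF s) (F0 s)).
transitivity (\int[mu]_t \int[mu]_x F s (x, t))%E; last first.
  by apply: eq_integral => t _; rewrite /wint; under [LHS]eq_integral do rewrite FE.
rewrite -(fubini_tonelli (m1 := mu) (m2 := mu) (F s) (mF s) (F0 s)).
apply: eq_integral => x _; under eq_integral do rewrite FE.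
rewrite ge0_integralZr//; last 2 first.
- by apply/measurable_EFinP; rewrite layer_indicE; exact: measurable_indic.
- exact: slack_ge0.
by rewrite -layerE// weight_ge0.
Qed.

(* Layer-cake: a monotone weight is a mixture of indicators of up-sets (down-sets),
   to which the log-concavity argument applies. *)
Lemma rmono_iwint_mixture b n (f : 'I_n -> _) (g : 'I_n -> _) N C :
  (forall i, young_function (f i)) -> (forall i, weight (g i)) ->
  (forall i, layered b (g i)) -> profile N -> (forall s, 0 <= C s)%E ->
  (forall J, (forall i, dirsegment b (J i)) ->
     rmono b (iwint f (fun i => \1_(J i)) N) C) ->
  rmono b (iwint f g N) C.
Proof.
elim: n f g N => [|n IH] f g N yf wg lg pN C0 H.
  by apply: (H (fun=> set0)) => -[].
move=> s t st /=; set fs := fun i => f (lift ord0 i).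
set gs := fun i => g (lift ord0 i).
have yfs i : young_function (fs i) by exact: yf.
have wgs i : weight (gs i) by exact: wg.
have pG : profile (iwint fs gs N) by exact: profile_iwint.
have [mL EL] := wint_layers (yf ord0) (wg ord0) pG.
have wl r : weight (\1_(layer (g ord0) r) : R -> R).
  by apply: weight_indic; apply: segment_measurable; exact: (lg _ _).1.
have L0 r q : (0 <= wint (f ord0) \1_(layer (g ord0) r) (iwint fs gs N) q)%E.
  by apply: profile_ge0; exact: profile_wint.
have Z q c : (0 <= c)%E -> (wint (f ord0) (g ord0) (iwint fs gs N) q * c =
    \int[mu]_r (wint (f ord0) \1_(layer (g ord0) r) (iwint fs gs N) q * c))%E.
  move=> c0; rewrite EL; apply/esym.
  by apply: ge0_integralZr => //; exact: mL.
rewrite !Z//.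
apply: ge0_le_integral => //.
- by move=> r _; rewrite mule_ge0.
- by apply: emeasurable_funM; [exact: mL|exact: measurable_cst].
- by apply: emeasurable_funM; [exact: mL|exact: measurable_cst].
(* Coordinate 0, reduced to the layer at height r, is absorbed into the base profile while the other
   weights are decomposed; [H] is then applied to the family with this layer put back in front. *)
move=> r _; rewrite !wint_iwintC//.
apply: IH st => //; [by move=> i; exact: lg|exact: profile_wint|].
move=> J sJ q q' qq'.
have wJ i : weight (\1_(J i) : R -> R).
  by apply: weight_indic; apply: segment_measurable; exact: (sJ i).1.
have := H (fun i => if unlift ord0 i is Some j then J j else layer (g ord0) r).
have E p : iwint f (fun i =>
    \1_(if unlift ord0 i is Some j then J j else layer (g ord0) r)) N p =
    wint (f ord0) \1_(layer (g ord0) r) (iwint fs (fun i => \1_(J i)) N) p.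
  rewrite /= unlift_none; apply: eq_wint => // p'.
  by apply: eq_iwint => // i x _; rewrite liftK.
move=> /(_ _ q q' qq'); rewrite !E !wint_iwintC//; apply=> i.
by case: unliftP => [j _|_]; [exact: sJ|exact: lg].
Qed.

Definition single n (k : 'I_n) (h : R -> R) (i : 'I_n) : R -> R :=
  if i == k then h else fun=> 1.

(** Given the first coordinate x, the others live at level s - f x, and the conditional mean of the
    product of their weights is G / C. By [rGC] it is monotone in the level in the sense of [b],
    hence monotone in x against g; Chebyshev's inequality separates the two factors. *)
Lemma iwint_negative_dependence b n (f : 'I_n -> _) (g : 'I_n -> _) N s :
  (forall i, young_function (f i)) -> (forall i, weight (g i)) ->
  (forall i, layered b (g i)) -> profile N -> logconcave N ->
  iwint f (fun i => fun=> 1) N s = 1%E ->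
  (iwint f g N s <= \prod_(i < n) iwint f (single i (g i)) N s)%E.
Proof.
elim: n f g N => [|n IH] f g N yf wg lg pN lN /=.
  by rewrite big_ord0 => ->.
have w1 := weight1.
set fs := fun i => f (lift ord0 i); set gs := fun i => g (lift ord0 i).
set G := iwint fs gs N; set C := iwint fs _ N => C1.
have yfs i : young_function (fs i) by exact: yf.
have wgs i : weight (gs i) by exact: wg.
have lgs i : layered b (gs i) by exact: lg.
have ws i h k : weight h -> weight (single i h k : R -> R).
  by move=> wh; rewrite /single; case: ifP.
have pG : profile G by exact: profile_iwint.
have pC : profile C by exact: profile_iwint.
have rGC : rmono b G C.
  apply: rmono_iwint_mixture => //; first by move=> r; exact: profile_ge0.
  by move=> J sJ; exact: rmono_iwint_indic.
have bg : dirmono b (g ord0).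
  by apply: layered_mono => // x; exact: weight_ge0 (wg ord0).
have mG := measurable_profile pG; have mC := measurable_profile pC.
have step : (wint (f ord0) (g ord0) G s * wint (f ord0) (fun=> 1%R) C s <=
    wint (f ord0) (g ord0) C s * wint (f ord0) (fun=> 1%R) G s)%E.
  rewrite (wint1E _ C) (wint1E _ G); apply: (wint_chebyshev (wg ord0).1 (fun x => weight_ge0 x (wg ord0)) bg).
  - exact: measurable_slack.
  - exact: measurable_slack.
  - by move=> x; rewrite profile_slack_ge0// profile_slack_lty.
  - by move=> x; rewrite profile_slack_ge0// profile_slack_lty.
  - by move=> x; exact: slack_neg.
  - by move=> x; exact: slack_neg.
  move=> x y x0 y0 xy; rewrite /slack x0 y0/=.
  case: ifPn => fy; last by rewrite mul0e; case: ifP; rewrite ?mule0.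
  case: ifPn => fx; last by rewrite mule0 mul0e.
  apply: rGC.
  have fyf : f ord0 `|y|%R \is a fin_num by rewrite ge0_fin_numE ?young_ge0.
  have fxf : f ord0 `|x|%R \is a fin_num by rewrite ge0_fin_numE ?young_ge0.
  case: b xy {IH lg lgs bg} => /= xy; rewrite lerB// fine_le// young_norm_le//.
    by rewrite !ger0_norm.
  by rewrite !ger0_norm.
rewrite C1 mule1 in step; apply: (le_trans step); rewrite big_ord_recl; apply: lee_pmul.
- by apply: profile_ge0; exact: profile_wint.
- by apply: profile_ge0; exact: profile_wint.
- rewrite le_eqVlt; apply/orP; left; apply/eqP.
  by rewrite /= /single eqxx; apply: eq_wint => // r; apply: eq_iwint.
(* Coordinate 0 is now unweighted and moves into the base profile. *)
rewrite /G wint_iwintC//.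
have IHs : (iwint fs gs (wint (f ord0) (fun=> 1%R) N) s <= \prod_(i < n)
    iwint fs (single i (gs i)) (wint (f ord0) (fun=> 1%R) N) s)%E.
  apply: IH => //; [exact: profile_wint|exact: logconcave_wint1|].
  by rewrite -wint_iwintC.
apply: (le_trans IHs); rewrite le_eqVlt; apply/orP; left; apply/eqP.
by apply: eq_bigr => i _; rewrite -wint_iwintC// => k; exact: ws.
Qed.

(** With all other coordinates integrated out, x |-> N' (s - f k x) is the unnormalised density of
    |x_k|; log-concavity of N' is what the moment estimates use. *)
Lemma iwint_single n (f : 'I_n -> _) (k : 'I_n) N :
  (forall i, young_function (f i)) -> profile N -> logconcave N ->
  exists N', [/\ profile N', logconcave N' & forall g, nnweight g ->
    forall s, iwint f (single k g) N s = wint (f k) g N' s].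
Proof.
elim: n f k => [|n IH] f k yf pN lN; first by case: k.
have w1 := weight1; have nn1 := weight_nn w1.
set fs := fun i => f (lift ord0 i).
have yfs i : young_function (fs i) by exact: yf.
case: (unliftP ord0 k) => [j|] ->.
  have [N' [pN' lN' H]] := IH fs j yfs pN lN.
  exists (wint (f ord0) (fun=> 1) N'); split.
  - exact: profile_wint.
  - exact: logconcave_wint1.
  - move=> g wg s; rewrite -wintC//= /single.
    by apply: eq_wint => // r; rewrite -H.
exists (iwint fs (fun=> \1_setT) N); split.
- by apply: profile_iwint => // i; exact: weight_indic.
- by apply: logconcave_iwint => // i; exact: segmentT.
- move=> g wg s /=; rewrite /single eqxx; apply: eq_wint => // r.
  by apply: eq_iwint => // i x _; rewrite indicT.
Qed.

End negative_dependence.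

(** * One-dimensional marginals *)

Section marginal.
Context {R : realType}.
Local Notation mu := (@lebesgue_measure R).
Implicit Types (x y : R) (f : R -> \bar R) (g h : R -> R) (N : R -> \bar R).

Definition shiftr (v : R) (x : measurableTypeR R) : measurableTypeR R := x - v.

Lemma measurable_shiftr v : measurable_fun setT (shiftr v).
Proof. exact: measurable_funB. Qed.

HB.instance Definition _ v :=
  isMeasurableFun.Build _ _ _ _ (shiftr v) (measurable_shiftr v).

Lemma lebesgue_measure_shift v (A : set R) : measurable A ->
  pushforward mu (shiftr v) A = mu A.
Proof.
move=> mA; apply/esym/lebesgue_measure_unique => //= _ [[a b]] _ <-.
rewrite /pushforward/= (_ : _ @^-1` _ = `]a + v, b + v]%classic); last first.
  by apply/seteqP; split=> x /=; rewrite /shiftr !in_itv/= ltrBrDr lerBlDr.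
rewrite !lebesgue_measure_itv/= !lte_fin ltrD2r.
by case: ifP => // _; rewrite -!EFinD; congr (_%:E); ring.
Qed.

Lemma ge0_integral_shift v (F : R -> \bar R) :
  measurable_fun setT F -> (forall x, 0 <= F x)%E ->
  (\int[mu]_x F x = \int[mu]_x F (x - v)%R)%E.
Proof.
move=> mF F0.
have := ge0_integral_pushforward (measurable_shiftr v) mu measurableT mF.
rewrite preimage_setT => /(_ (fun x _ => F0 x)) <-.
by apply: eq_measure_integral => A mA _; exact/esym/lebesgue_measure_shift.
Qed.

(** The ratio p (x + v) / p x decreases in x for the density p of a marginal. Convexity gives f y +
    f (x + v) <= f x + f (y + v), and [logconcave_swap] together with the monotonicity of N
    transfers this to the levels. *)
Lemma slack_shift f N s x y v : young_function f -> profile N ->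
  logconcave N -> 0 <= x -> x <= y -> 0 <= v ->
  (slack f N s (y + v)%R * slack f N s x <=
   slack f N s (x + v)%R * slack f N s y)%E.
Proof.
move=> yf pN lN x0 xy v0; have N0 t := profile_ge0 t pN.
have y0 := le_trans x0 xy.
have yv0 : 0 <= y + v by rewrite addr_ge0.
have xv0 : 0 <= x + v by rewrite addr_ge0.
have [->|v0'] := eqVneq v 0; first by rewrite !addr0 muleC.
have vp : 0 < v by rewrite lt_neqAle eq_sym v0'.
rewrite /slack x0 y0 yv0 xv0/=.
case: ifPn => fyv; last by rewrite mul0e mule_ge0//; case: ifP.
have le z : 0 <= z -> z <= y + v -> (f `|z|%R <= f `|y + v|%R)%E.
  by move=> z0 zy; apply: young_norm_le => //; rewrite !ger0_norm.
have fin z : 0 <= z -> z <= y + v -> f `|z|%R \is a fin_num.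
  move=> z0 zy; rewrite ge0_fin_numE ?young_ge0//.
  exact: le_lt_trans (le z z0 zy) fyv.
have lt z : 0 <= z -> z <= y + v -> (f `|z|%R < +oo)%E.
  by move=> z0 zy; rewrite -ge0_fin_numE ?young_ge0// fin.
have hx : x <= y + v by lra.
have hy : y <= y + v by lra.
have hxv : x + v <= y + v by lra.
rewrite !lt//.
have cv t : 0 <= t <= 1 -> fine (f `|t * x + (1 - t) * (y + v)|%R) <=
    t * fine (f `|x|%R) + (1 - t) * fine (f `|y + v|%R).
  move=> t01; have z0 : 0 <= t * x + (1 - t) * (y + v).
    by case/andP: t01 => t0 t1; rewrite addr_ge0// mulr_ge0// subr_ge0.
  have zy : t * x + (1 - t) * (y + v) <= y + v by nra.
  rewrite -lee_fin fineK ?fin// EFinD !EFinM !fineK ?fin//.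
  rewrite !(ger0_norm z0) (ger0_norm x0) (ger0_norm yv0).
  by case: yf => _ + _ _ _; apply.
(* Both y and x + v are convex combinations of x and y + v, with exchanged weights v / T and 1 - v /
   T. *)
pose T := y + v - x; have T0 : 0 < T by rewrite /T; lra.
have t01 : 0 <= v / T <= 1.
  by rewrite divr_ge0 ?(ltW T0)//= ler_pdivrMr// /T; lra.
have t01' : 0 <= 1 - v / T <= 1 by lra.
have h1 := cv _ t01; have h2 := cv _ t01'.
have e1 : v / T * x + (1 - v / T) * (y + v) = y by rewrite /T; field; rewrite -/T gt_eqF.
have e2 : (1 - v / T) * x + (1 - (1 - v / T)) * (y + v) = x + v.
  by rewrite /T; field; rewrite -/T gt_eqF.
rewrite e1 in h1; rewrite e2 in h2.
have fm1 : fine (f `|x|%R) <= fine (f `|x + v|%R).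
  by apply: fine_le; rewrite ?fin//; apply: young_norm_le => //; rewrite !ger0_norm//; lra.
have fm2 : fine (f `|x + v|%R) <= fine (f `|y + v|%R).
  by apply: fine_le; rewrite ?fin//; exact: le.
move: (fine (f `|x|%R)) (fine (f `|y|%R)) (fine (f `|x + v|%R))
  (fine (f `|y + v|%R)) h1 h2 fm1 fm2 => a b c d h1 h2 fm1 fm2.
have sw : (N (s - d)%R * N (s - a)%R <=
    N (s - c)%R * N (s - d + (s - a) - (s - c))%R)%E.
  by apply: logconcave_swap => //; lra.
apply: (le_trans sw); apply: lee_wpmul2l => //.
by case: pN => _ + _; apply; lra.
Qed.

(** Weights are compared only on the support of the slice, which is bounded; this is how e^{x/4} can
    be dominated by a constant. *)
Lemma le_wint_ge0 f h1 h2 N s : young_function f -> profile N ->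
  measurable_fun setT h1 -> measurable_fun setT h2 ->
  (forall x, 0 <= h1 x) ->
  (forall x, 0 <= x -> slack f N s x != 0%E -> h1 x <= h2 x) ->
  (wint f h1 N s <= wint f h2 N s)%E.
Proof.
move=> yf pN m1 m2 h10 H; have mN := measurable_profile pN.
have N0 t := profile_ge0 t pN.
rewrite /wint.
have E (h : R -> R) : (\int[mu]_x ((h x)%:E * slack f N s x) =
    \int[mu]_x (if slack f N s x != 0 then (h x)%:E * slack f N s x else 0))%E.
  apply: eq_integral => x _; case: ifPn => //.
  by rewrite negbK => /eqP ->; rewrite mule0.
apply: ge0_le_integral => //.
- by move=> x _; apply: wintegrand_ge0.
- exact: measurable_wintegrand.
- exact: measurable_wintegrand.
move=> x _; have [->|sl] := eqVneq (slack f N s x) 0%E; first by rewrite !mule0.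
have [x0|x0] := ltP x 0; first by rewrite slack_neg// !mule0.
by apply: lee_wpmul2r; [exact: slack_ge0|rewrite lee_fin H].
Qed.

Lemma wintD f h1 h2 N s : young_function f -> profile N ->
  measurable_fun setT h1 -> measurable_fun setT h2 ->
  (forall x, 0 <= h1 x) -> (forall x, 0 <= h2 x) ->
  (wint f (fun x => h1 x + h2 x)%R N s = wint f h1 N s + wint f h2 N s)%E.
Proof.
move=> yf pN m1 m2 h10 h20; have mN := measurable_profile pN.
have N0 t := profile_ge0 t pN.
rewrite /wint -ge0_integralD//.
- by apply: eq_integral => x _; rewrite EFinD ge0_muleDl ?lee_fin.
- by move=> x _; exact: wintegrand_ge0.
- exact: measurable_wintegrand.
- by move=> x _; exact: wintegrand_ge0.
- exact: measurable_wintegrand.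
Qed.

Lemma wintZ f h N s (c : R) : young_function f -> profile N ->
  measurable_fun setT h -> (forall x, 0 <= h x) -> 0 <= c ->
  (wint f (fun x => c * h x)%R N s = c%:E * wint f h N s)%E.
Proof.
move=> yf pN mh h0 c0; have mN := measurable_profile pN.
have N0 t := profile_ge0 t pN.
rewrite /wint -ge0_integralZl//.
- by apply: eq_integral => x _; rewrite EFinM muleA.
- exact: measurable_wintegrand.
- by move=> x _; exact: wintegrand_ge0.
Qed.

Lemma measurable_tail (v : R) : measurable_fun setT (fun x => (v <= x)%R%:R : R).
Proof.
rewrite (_ : (fun _ => _) = \1_`[v, +oo[); first exact: measurable_indic.
by apply/funext => x; rewrite indicE mem_setE in_itv/= andbT.
Qed.

(* Log-concavity of the density: beyond [v], the excess over [v] is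
   stochastically dominated by the variable itself. *)
Lemma wint_excess f h N s v : young_function f -> profile N ->
  logconcave N -> measurable_fun setT h -> (forall x, 0 <= h x) ->
  (forall x y, 0 <= x -> x <= y -> h x <= h y) -> 0 <= v ->
  wint f (fun=> 1)%R N s = 1%E ->
  (wint f (fun x => (v <= x)%R%:R * h (x - v))%R N s <=
   wint f (fun x => (v <= x)%R%:R)%R N s * wint f h N s)%E.
Proof.
move=> yf pN lN mh h0 ndh v0 n1; have mN := measurable_profile pN.
have N0 t := profile_ge0 t pN.
(* The unnormalised density of the excess over [v]; its ratio to the density of the variable itself
   is nonincreasing by [slack_shift]. *)
pose q x := ((0 <= x)%R%:R%:E * slack f N s (x + v)%R)%E.
have mq : measurable_fun setT q.
  apply: emeasurable_funM; first by apply/measurable_EFinP; exact: measurable_tail.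
  by apply: measurable_slack => //; exact: measurable_funD.
have q0 x : (0 <= q x)%E by rewrite mule_ge0 ?lee_fin//; exact: slack_ge0.
have E (k : R -> R) : measurable_fun setT k -> (forall x, 0 <= k x) ->
    wint f (fun x => (v <= x)%R%:R * k (x - v))%R N s =
    (\int[mu]_x ((k x)%:E * q x))%E.
  move=> mk k0; rewrite [RHS](ge0_integral_shift v).
  - apply: eq_integral => x _; rewrite /q subrK subr_ge0 muleA -EFinM.
    by rewrite [k _ * _]mulrC.
  - by apply: emeasurable_funM => //; exact/measurable_EFinP.
  - by move=> x; rewrite mule_ge0// lee_fin.
have E1 : wint f (fun x => (v <= x)%R%:R)%R N s = (\int[mu]_x q x)%E.
  have := E (fun=> 1) weight1.1 (fun=> ler01).
  under eq_integral do rewrite mul1e.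
  by move=> <-; apply: eq_wint => // x _; rewrite mulr1.
rewrite E// E1 [leRHS]muleC -[leLHS]mule1 -[X in (_ * X <= _)%E]n1 wint1E.
apply: (wint_chebyshev (b := true)) => //.
- by move=> x y x0 y0 /= xy; exact: ndh.
- exact: measurable_slack.
- by move=> x; rewrite profile_slack_ge0// profile_slack_lty.
- move=> x; rewrite q0/= /q; case: (0 <= x); rewrite ?mul0e ?ltry//.
  by rewrite mul1e profile_slack_lty.
- by move=> x; exact: slack_neg.
- by move=> x x0; rewrite /q leNgt x0 mul0e.
- by move=> x y x0 y0 /= xy; rewrite /q x0 y0 !mul1e; exact: slack_shift.
Qed.

(** Let q = P(X < e), r = 1 - q and m = E X. The excess over e is dominated by X, so m <= e + r m
    and L^2 <= e^2 + 2 e r m + r L^2. Thus q m <= e, and multiplying q L^2 <= e^2 + 2 e r m by q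
    gives q^2 L^2 <= q e^2 + 2 r e^2 <= 2 e^2. *)
Lemma wint_small f N s (e L : R) : young_function f -> profile N ->
  logconcave N -> 0 < e ->
  wint f (fun=> 1)%R N s = 1%E -> wint f (fun x => x ^+ 2)%R N s = (L ^+ 2)%:E ->
  exists q, [/\ 0 <= q, wint f \1_[set x | x < e] N s = q%:E &
    q ^+ 2 * L ^+ 2 <= 2 * e ^+ 2].
Proof.
move=> yf pN lN e0 n1 n2; have N0 t := profile_ge0 t pN.
have ge0 (h : R -> R) : (forall x, 0 <= h x) -> (0 <= wint f h N s)%E.
  by move=> h0; exact: wint_ge0.
have me := measurable_tail e.
pose lo : R -> R := \1_[set x | x < e].
have mlo : measurable_fun setT lo.
  by apply: measurable_indic; rewrite (_ : [set x | x < e] = `]-oo, e[%classic)//;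
    apply/seteqP; split=> x /=; rewrite in_itv.
have loE x : lo x = (x < e)%R%:R.
  rewrite /lo indicE; suff -> : (x \in [set x | x < e]) = (x < e) by [].
  by apply/idP/idP => [/set_mem//|xe]; exact: mem_set.
have lo0 x : 0 <= lo x by rewrite loE.
have t0 x : 0 <= (e <= x)%R%:R :> R by [].
have ma : measurable_fun setT (fun x : R => `|x|) by exact: measurableT_comp.
have m2 : measurable_fun setT (fun x : R => x ^+ 2) by exact: measurable_funX.
have s0 x : 0 <= x ^+ 2 by exact: sqr_ge0.
have qr : (wint f lo N s + wint f (fun x => (e <= x)%R%:R)%R N s = 1)%E.
  rewrite -wintD// -n1; apply: eq_wint => // x _; rewrite loE leNgt.
  by case: (x < e); rewrite ?addr0 ?add0r.
have fin (X : \bar R) (c : R) : (0 <= X)%E -> (X <= c%:E)%E ->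
    exists2 r, 0 <= r & X = r%:E.
  by case: X => [r| |]//; rewrite lee_fin => r0 _; exists r.
have [q q0 Eq] : exists2 q, 0 <= q & wint f lo N s = q%:E.
  by apply: (fin _ 1); [exact: ge0|rewrite -qr leeDl// ge0].
have [r r0 Er] : exists2 q, 0 <= q & wint f (fun x => (e <= x)%R%:R)%R N s = q%:E.
  by apply: (fin _ 1); [exact: ge0|rewrite -qr leeDr// ge0].
have {}qr : q + r = 1 by move: qr; rewrite Eq Er -EFinD => -[].
have [m m0 Em] : exists2 q, 0 <= q & wint f (fun x => `|x|)%R N s = q%:E.
  apply: (fin _ (1 + L ^+ 2)); first exact: ge0.
  rewrite EFinD -n1 -n2 -wintD//; apply: le_wint_ge0 => //.
    by apply: measurable_funD.
  by move=> x x0 _; rewrite ger0_norm//; nra.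
have X1 := wint_excess yf pN lN ma (fun x => normr_ge0 x) _ (ltW e0) n1.
have {}X1 : (wint f (fun x => (e <= x)%R%:R * `|x - e|)%R N s <= (r * m)%:E)%E.
  by rewrite EFinM -Er -Em; apply: X1 => x y x0 xy; rewrite !ger0_norm//; lra.
have X2 := wint_excess yf pN lN m2 s0 _ (ltW e0) n1.
have {}X2 : (wint f (fun x => (e <= x)%R%:R * (x - e) ^+ 2)%R N s <=
    (r * L ^+ 2)%:E)%E.
  by rewrite EFinM -Er -n2; apply: X2 => x y x0 xy; nra.
have mx1 : measurable_fun setT (fun x : R => (e <= x)%R%:R * `|x - e|).
  apply: measurable_funM => //.
  by apply: measurableT_comp => //; exact: measurable_funB.
have mx2 : measurable_fun setT (fun x : R => (e <= x)%R%:R * (x - e) ^+ 2).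
  apply: measurable_funM => //.
  by apply: measurable_funX; exact: measurable_funB.
have x10 x : 0 <= (e <= x)%R%:R * `|x - e| by rewrite mulr_ge0.
have x20 x : 0 <= (e <= x)%R%:R * (x - e) ^+ 2 by rewrite mulr_ge0// sqr_ge0.
have m1 : m <= e + r * m.
  rewrite -lee_fin EFinD -Em -[e%:E]mule1 -n1 -wintZ//; last exact: ltW.
  apply: (@le_trans _ _ (wint f (fun x => e * 1 + (e <= x)%R%:R * `|x - e|)%R N s)).
    apply: le_wint_ge0 => //; first exact: measurable_funD.
    move=> x x0 _; rewrite ger0_norm//; have [ex|xe] := leP e x; rewrite /= ?mulr1n ?mulr0n.
      by rewrite ger0_norm ?subr_ge0//; lra.
    by lra.
  rewrite wintD//; first by apply: leeD.
  by move=> x; rewrite mulr1 ltW.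
have hm2 : L ^+ 2 <= e ^+ 2 + (2 * e * (r * m) + r * L ^+ 2).
  rewrite -lee_fin -n2.
  pose k x := e ^+ 2 * 1 + (2 * e * ((e <= x)%R%:R * `|x - e|) +
     (e <= x)%R%:R * (x - e) ^+ 2).
  have e2 : 0 <= 2 * e by lra.
  have mk1 : measurable_fun setT (fun x : R => 2 * e * ((e <= x)%R%:R * `|x - e|)).
    exact: measurable_funM.
  apply: (@le_trans _ _ (wint f k N s)).
    apply: le_wint_ge0 => //; first by apply: measurable_funD => //; exact: measurable_funD.
    move=> x x0 _; rewrite /k; have [ex|xe] := leP e x; rewrite /= ?mulr1n ?mulr0n.
      by rewrite ger0_norm ?subr_ge0//; nra.
    by nra.
  rewrite /k wintD//; last 3 first.
  - exact: measurable_funD.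
  - by move=> x; rewrite mulr1.
  - by move=> x; rewrite addr_ge0// mulr_ge0.
  rewrite wintD//; last by move=> x; rewrite mulr_ge0.
  rewrite !wintZ// n1 mule1 !EFinD; apply: leeD => //.
  by apply: leeD => //; rewrite [leRHS]EFinM; apply: lee_wpmul2l.
exists q; split=> //.
have h1 : q * m <= e by nra.
have h2 : q * L ^+ 2 <= e ^+ 2 + 2 * e * r * m by nra.
have q1 : q <= 1 by lra.
have : q * (q * L ^+ 2) <= q * e ^+ 2 + 2 * e * r * (q * m) by nra.
have : 2 * e * r * (q * m) <= 2 * e * r * e by rewrite ler_wpM2l// !mulr_ge0//; lra.
have -> : r = 1 - q by lra.
have : 0 <= e ^+ 2 by exact: sqr_ge0.
nra.
Qed.

(** With W = E e^{X/4}, Markov gives P(X >= 2) <= 1/4. Splitting at 2 and dominating the excess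
    yields W <= 2 + 2 (W / 4), where 2 bounds e^{1/2}; hence W <= 4. *)
Lemma wint_exp_moment f N s : young_function f -> profile N ->
  logconcave N ->
  wint f (fun=> 1)%R N s = 1%E -> (wint f (fun x => x ^+ 2)%R N s <= 1)%E ->
  (wint f (fun x => expR (x / 4))%R N s <= 4%:E)%E.
Proof.
move=> yf pN lN n1 n2; have N0 t := profile_ge0 t pN.
have ge0 (h : R -> R) : (forall x, 0 <= h x) -> (0 <= wint f h N s)%E.
  by move=> h0; exact: wint_ge0.
have m2 : measurable_fun setT (fun x : R => x ^+ 2) by exact: measurable_funX.
have s0 x : 0 <= x ^+ 2 by exact: sqr_ge0.
have mt := measurable_tail 2.
have me : measurable_fun setT (fun x : R => expR (x / 4)).
  by apply: measurableT_comp => //; exact: measurable_funM.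
have ex0 x : 0 <= expR (x / 4) by exact: expR_ge0.
have [b [b0 hb]] := profile_slack_bound s yf pN.
(* Finiteness lets W / 2 be absorbed on the left; the bound expR (b / 4), which depends on the
   profile, serves for nothing else. *)
have [W [W0 EW]] : exists W : R, 0 <= W /\ wint f (fun x => expR (x / 4))%R N s = W%:E.
  have : (wint f (fun x => expR (x / 4))%R N s <= (expR (b / 4))%:E)%E.
    rewrite -[leRHS]mule1 -n1 -wintZ//.
    apply: le_wint_ge0 => // x x0 sx; rewrite mulr1 ler_expR ler_pM2r//.
    by rewrite leNgt; apply: contra_neqN sx; exact: hb.
  have := ge0 _ ex0.
  by case: (wint _ _ _ _) => [r| |]//; rewrite lee_fin => r0 _; exists r.
have rho : (wint f (fun x => (2 <= x)%R%:R)%R N s <= 4^-1%:E)%E.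
  apply: (@le_trans _ _ (wint f (fun x => 4^-1 * x ^+ 2)%R N s)).
    apply: le_wint_ge0 => //; first exact: measurable_funM.
    move=> x x0 _; have [x2|x2] := leP 2 x; rewrite /= ?mulr1n ?mulr0n; last by rewrite mulr_ge0.
    by nra.
  by rewrite wintZ// -[leRHS]mule1; apply: lee_wpmul2l => //; rewrite lee_fin.
have nde x y : 0 <= x -> x <= y -> expR (x / 4) <= expR (y / 4).
  by move=> _ xy; rewrite ler_expR ler_pM2r.
have X := wint_excess yf pN lN me ex0 nde (ler0n R 2) n1.
have {}X : (wint f (fun x => (2 <= x)%R%:R * expR ((x - 2) / 4))%R N s <= (4^-1 * W)%:E)%E.
  by apply: (le_trans X); rewrite EW EFinM; apply: lee_wpmul2r => //; rewrite lee_fin.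
have mX : measurable_fun setT (fun x : R => (2 <= x)%R%:R * expR ((x - 2) / 4)).
  apply: measurable_funM => //; apply: measurableT_comp => //.
  by apply: measurable_funM => //; exact: measurable_funB.
have X0 x : 0 <= (2 <= x)%R%:R * expR ((x - 2) / 4) by rewrite mulr_ge0// expR_ge0.
have e12 : expR 2^-1 <= 2 :> R.
  have := expR_ge1Dx (- 2^-1 : R); rewrite expRN => h.
  have := expR_gt0 (2^-1 : R) => p.
  rewrite -[leRHS]invrK -[leLHS]invrK lef_pV2 ?posrE ?invr_gt0//; lra.
have : W <= 2 + 2 * (4^-1 * W).
  rewrite -lee_fin -EW EFinD [(2 * _)%:E]EFinM.
  apply: (@le_trans _ _ (wint f (fun x => 2 * 1 +
     2 * ((2 <= x)%R%:R * expR ((x - 2) / 4)))%R N s)).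
    apply: le_wint_ge0 => //.
      by apply: measurable_funD => //; exact: measurable_funM.
    move=> x x0 _; have [x2|x2] := leP 2 x; rewrite /= ?mulr1n ?mulr0n.
      have -> : x / 4 = 2^-1 + (x - 2) / 4 by field.
      rewrite expRD mul1r; have := expR_ge0 ((x - 2) / 4); nra.
    rewrite mul0r mulr0 addr0 mulr1; apply: le_trans e12.
    by rewrite ler_expR; lra.
  rewrite wintD//; try by [exact: measurable_funM|move=> x; rewrite mulr_ge0].
  apply: leeD; first by rewrite wintZ// n1 mule1.
  by rewrite wintZ//; apply: lee_wpmul2l.
by rewrite EW lee_fin; lra.
Qed.

Lemma wint_tail f N s u : young_function f -> profile N ->
  logconcave N ->
  wint f (fun=> 1)%R N s = 1%E -> (wint f (fun x => x ^+ 2)%R N s <= 1)%E ->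
  (wint f (fun x => (u <= x)%R%:R)%R N s <= (4 * expR (- (u / 4)))%:E)%E.
Proof.
move=> yf pN lN n1 n2; have W := wint_exp_moment yf pN lN n1 n2.
have me : measurable_fun setT (fun x : R => expR (x / 4)).
  by apply: measurableT_comp => //; exact: measurable_funM.
have mt := measurable_tail u.
rewrite mulrC EFinM.
apply: (@le_trans _ _ (wint f (fun x => expR (- (u / 4)) * expR (x / 4))%R N s)).
  apply: le_wint_ge0 => //; first exact: measurable_funM.
  move=> x x0 _; rewrite -expRD; have [ux|_] := leP u x; rewrite /= ?mulr1n ?mulr0n; last exact: expR_ge0.
  by rewrite -[leLHS]expR0 ler_expR; lra.
by rewrite wintZ// ?expR_ge0//; apply: lee_wpmul2l; rewrite ?lee_fin ?expR_ge0.
Qed.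

(** From y <= e^y at y = x / 16, x^4 <= 2^16 e^{x/4}; the exponential moment contributes the
    remaining factor 4. *)
Lemma wint_fourth_moment f N s : young_function f -> profile N ->
  logconcave N ->
  wint f (fun=> 1)%R N s = 1%E -> (wint f (fun x => x ^+ 2)%R N s <= 1)%E ->
  (wint f (fun x => x ^+ 4)%R N s <= (2 ^+ 18)%:E)%E.
Proof.
move=> yf pN lN n1 n2; have W := wint_exp_moment yf pN lN n1 n2.
have me : measurable_fun setT (fun x : R => expR (x / 4)).
  by apply: measurableT_comp => //; exact: measurable_funM.
have -> : (2 ^+ 18)%:E = ((2 ^+ 16)%:E * 4%:E :> \bar R)%E.
  by rewrite -EFinM; congr (_%:E); ring.
apply: (@le_trans _ _ (wint f (fun x => 2 ^+ 16 * expR (x / 4))%R N s)).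
  apply: le_wint_ge0 => //.
  - exact: measurable_funM.
  - by move=> x; rewrite (exprM x 2 2) sqr_ge0.
  move=> x x0 _; have -> : expR (x / 4) = expR (x / 16) ^+ 4.
    by rewrite -expRM_natl; congr expR; field.
  have h : x / 16 <= expR (x / 16) by apply: le_trans (expR_ge1Dx _); lra.
  have -> : x ^+ 4 = 2 ^+ 16 * (x / 16) ^+ 4 by field.
  by rewrite ler_pM2l// lerXn2r// nnegrE ?expR_ge0// divr_ge0.
by rewrite wintZ//; apply: lee_wpmul2l; rewrite ?lee_fin.
Qed.

End marginal.

(** * Integrals over an Orlicz ball *)

Section orlicz_integral.
Context {R : realType}.
Local Notation mu := (@lebesgue_measure R).
Implicit Types (x y s : R) (f : R -> \bar R) (g h : R -> R) (N : R -> \bar R).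

Lemma ge0_even_integral (k : R -> \bar R) : measurable_fun setT k ->
  (forall x, 0 <= k x)%E -> (forall x, x < 0 -> k x = 0%E) ->
  (\int[mu]_x k `|x|%R = 2%:E * \int[mu]_x k x)%E.
Proof.
move=> mk k0 kn.
have mka : measurable_fun setT (fun x : R => k `|x|) by exact: measurableT_comp.
have -> : (\int[mu]_x k x = \int[mu]_(x in `[0%R, +oo[) k x)%E.
  rewrite [RHS]integral_mkcond; apply: eq_integral => x _; rewrite patchE.
  by case: ifPn => //; rewrite notin_setE/= in_itv/= andbT => /negP; rewrite -ltNge => /kn.
rewrite -(setUv `[0%R, +oo[%classic) ge0_integral_setU//=; last 3 first.
- exact: measurableC.
- by rewrite setUv.
- exact/disj_setPCl.
rewrite mule_natl mule2n; congr +%E.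
  apply: eq_integral => x; rewrite inE/= in_itv/= andbT => x0.
  by rewrite ger0_norm.
rewrite setCitvr integral_itv_bndo_bndc; last exact: measurable_funTS.
rewrite ge0_integration_by_substitution0//.
apply: eq_integral => x; rewrite inE/= in_itv/= => x0.
by rewrite ler0_norm.
Qed.

Definition heaviside s : \bar R := if 0 <= s then 1%E else 0%E.

Lemma profile_heaviside (c : R) : 0 <= c ->
  profile (fun s => c%:E * heaviside s)%E.
Proof.
move=> c0; split.
- by move=> s; rewrite /heaviside; case: ifP => _; rewrite ?mule1 ?mule0 ?ltry ?lexx ?lee_fin ?c0.
- move=> s t st; apply: lee_wpmul2l; first by rewrite lee_fin.
  rewrite /heaviside; case: ifPn => s0; last by case: ifP.
  by rewrite (le_trans s0 st).
- by move=> s s0; rewrite /heaviside leNgt s0 mule0.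
Qed.

Lemma logconcave_heaviside (c : R) : logconcave (fun s => c%:E * heaviside s)%E.
Proof.
move=> u v a b th th01; rewrite /heaviside.
case: ifPn => u0; last by rewrite mule0 lee_fin leNgt expR_gt0.
rewrite mule1 lee_fin => ca.
case: ifPn => v0; last by rewrite mule0 lee_fin leNgt expR_gt0.
rewrite mule1 lee_fin => cb; case/andP: (th01) => t0 t1.
have t0' : 0 <= 1 - th by rewrite subr_ge0.
rewrite addr_ge0 ?mulr_ge0// mule1 lee_fin.
apply: le_trans (expR_convex _ _ th01) _.
by have := ler_wpM2l t0' ca; have := ler_wpM2l t0 cb; lra.
Qed.

Lemma wint_scale f g N s (c : R) : young_function f -> nnweight g ->
  (forall s, 0 <= N s)%E -> measurable_fun setT N -> 0 <= c ->
  wint f g (fun s => c%:E * N s)%E s = (c%:E * wint f g N s)%E.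
Proof.
move=> yf wg N0 mN c0.
rewrite /wint -ge0_integralZl//.
- apply: eq_integral => x _; rewrite muleCA /slack; case: ifP => //.
  by rewrite !mule0.
- exact: measurable_wintegrand wg.1 mN.
- by move=> x _; apply: wintegrand_ge0 => //; exact: wg.2.
Qed.

Lemma iwint_scale n (f : 'I_n -> R -> \bar R) (g : 'I_n -> R -> R) N s (c : R) :
  (forall i, young_function (f i)) -> (forall i, nnweight (g i)) ->
  (forall s, 0 <= N s)%E -> (forall s t, s <= t -> (N s <= N t)%E) -> 0 <= c ->
  iwint f g (fun s => c%:E * N s)%E s = (c%:E * iwint f g N s)%E.
Proof.
elim: n f g s => [|n IH] f g s yf wg N0 ndN c0 //=.
have [I0 ndI] := iwint_nondecreasing (fun i => yf (lift ord0 i))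
  (fun i => wg (lift ord0 i)) N0 ndN.
rewrite -wint_scale//; last exact: measurable_nondecreasing.
by apply: eq_wint => // r; rewrite IH.
Qed.

(** The level [s] is a parameter because fixing the first coordinate x gives the same kind of
    integrand at level s - f x. *)
Definition orlicz_integrand n (f : 'I_n -> R -> \bar R) (g : 'I_n -> R -> R)
    (s : R) (x : n.-tuple R) : \bar R :=
  ((\prod_(i < n) g i `|tnth x i|%R)%R%:E *
   if (\sum_(i < n) f i `|tnth x i|%R <= s%:E) then 1 else 0)%E.

Lemma measurable_orlicz_sum n (f : 'I_n -> R -> \bar R) :
  (forall i, young_function (f i)) ->
  measurable_fun setT (fun x : n.-tuple R => \sum_(i < n) f i `|tnth x i|%R)%E.
Proof.
move=> yf; apply: emeasurable_sum => i.
by apply: (measurableT_comp (measurable_young (yf i))); exact: measurable_tnth.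
Qed.

Lemma measurable_tuple_prod n (g : 'I_n -> R -> R) :
  (forall i, measurable_fun setT (g i)) ->
  measurable_fun setT (fun x : n.-tuple R => \prod_(i < n) g i `|tnth x i|).
Proof.
move=> mg; apply: measurable_prod => i _.
apply: (measurableT_comp (mg i)); apply: measurableT_comp => //.
exact: measurable_tnth.
Qed.

Lemma measurable_orlicz_integrand n (f : 'I_n -> R -> \bar R)
    (g : 'I_n -> R -> R) d (T : measurableType d) (sigma : T -> R)
    (xi : T -> n.-tuple R) :
  (forall i, young_function (f i)) -> (forall i, nnweight (g i)) ->
  measurable_fun setT sigma -> measurable_fun setT xi ->
  measurable_fun setT (fun t => orlicz_integrand f g (sigma t) (xi t)).
Proof.
move=> yf wg ms mx; apply: emeasurable_funM.
  apply/measurable_EFinP.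
  by apply: (measurableT_comp (measurable_tuple_prod _) mx) => i; exact: (wg i).1.
apply: measurable_fun_ifT => //; apply: measurable_fun_lee.
  exact: (measurableT_comp (measurable_orlicz_sum yf) mx).
exact/measurable_EFinP.
Qed.

Lemma orlicz_integrand_ge0 n (f : 'I_n -> R -> \bar R)
    (g : 'I_n -> R -> R) s (x : n.-tuple R) :
  (forall i, nnweight (g i)) -> (0 <= orlicz_integrand f g s x)%E.
Proof.
move=> wg; apply: mule_ge0; last by case: ifP.
by rewrite lee_fin prodr_ge0// => i _; exact: (wg i).2.
Qed.

Lemma orlicz_integrand_cons n (f : 'I_n.+1 -> R -> \bar R)
    (g : 'I_n.+1 -> R -> R) s (x : R) (t : n.-tuple R) :
  (forall i, young_function (f i)) ->
  orlicz_integrand f g s [tuple of x :: t] =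
  ((g ord0 `|x|%R)%:E * slack (f ord0) (fun r =>
     orlicz_integrand (fun i => f (lift ord0 i)) (fun i => g (lift ord0 i)) r t)
     s `|x|%R)%E.
Proof.
move=> yf; rewrite /orlicz_integrand big_ord_recl [X in (if X then _ else _)]/=.
rewrite big_ord_recl EFinM -muleA; congr (_ * _)%E; rewrite ?(tnth0)//.
rewrite /slack normr_ge0 normr_id/=.
have E i : tnth [tuple of x :: t] (lift ord0 i) = tnth t i by rewrite tnthS.
under eq_bigr do rewrite E; under [X in (_ + X <= _)%E]eq_bigr do rewrite E.
set S := (\sum_(i < n) _)%E.
have S0 : (0 <= S)%E by apply: sume_ge0 => i _; exact: young_ge0.
have f0 := @young_ge0 _ (f ord0) x (yf ord0).
have [fx|fx] := ltP (f ord0 `|x|%R) +oo%E.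
  have -> : (S <= (s - fine (f ord0 `|x|%R))%:E)%E = (f ord0 `|x|%R + S <= s%:E)%E.
    have ff : f ord0 `|x|%R \is a fin_num by rewrite ge0_fin_numE.
    by rewrite EFinB leeBrDr ?fineK// addeC.
  by [].
have -> : f ord0 `|x|%R = +oo%E by move: fx; rewrite leye_eq => /eqP.
by rewrite addye ?leye_eq//= ?mule0//; apply: contraTneq S0 => ->.
Qed.

Lemma lebesgue_tuple_cons_integral n (F : n.+1.-tuple R -> \bar R) :
  measurable_fun setT F -> (forall w, 0 <= F w)%E ->
  (\int[lebesgue_tuple R n.+1]_w F w =
   \int[mu]_x \int[lebesgue_tuple R n]_t F [tuple of x :: t])%E.
Proof.
move=> mF F0.
have mc : measurable_fun setT (@cons_pair R n) by exact: measurable_cons.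
transitivity (\int[pushforward (mu \x lebesgue_tuple R n)%E (@cons_pair R n)]_w F w)%E.
  exact: eq_measure_integral.
rewrite (ge0_integral_pushforward mc)// preimage_setT.
have mFc := measurableT_comp mF mc.
have F0c p : (0 <= (F \o @cons_pair R n) p)%E by exact: F0.
by rewrite (fubini_tonelli1 _ mFc F0c).
Qed.

(** Evenness in each coordinate reduces to the half-line at the cost of a factor 2, collected in the
    base profile as 2^n. *)
Lemma integral_orlicz n (f : 'I_n -> R -> \bar R) (g : 'I_n -> R -> R) s :
  (forall i, young_function (f i)) -> (forall i, nnweight (g i)) ->
  (\int[lebesgue_tuple R n]_w orlicz_integrand f g s w =
   iwint f g (fun r => (2 ^+ n)%R%:E * heaviside r) s)%E.
Proof.
elim: n f g s => [|n IH] f g s yf wg.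
  rewrite [LHS]integral_dirac//; last first.
    by apply: (measurable_orlicz_integrand (sigma := fun=> s) (xi := id)).
  rewrite diracT mul1e /orlicz_integrand !big_ord0/= expr0 !mul1e.
  by rewrite /heaviside lee_fin.
have yfs i : young_function (f (lift ord0 i)) by exact: yf.
have wgs i : nnweight (g (lift ord0 i)) by exact: wg.
rewrite lebesgue_tuple_cons_integral; last 2 first.
- by apply: (measurable_orlicz_integrand (sigma := fun=> s) (xi := id)).
- by move=> x; exact: orlicz_integrand_ge0.
set fs := fun i => f (lift ord0 i); set gs := fun i => g (lift ord0 i).
pose I r := (\int[lebesgue_tuple R n]_t orlicz_integrand fs gs r t)%E.
have mor : measurable_fun setT (fun p : R * n.-tuple R =>
    orlicz_integrand fs gs p.1 p.2).
  exact: measurable_orlicz_integrand.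
have mI : measurable_fun setT I.
  apply: (measurable_fun_fubini_tonelli_F (m2 := lebesgue_tuple R n) _ mor) => p.
  exact: orlicz_integrand_ge0.
have I0 r : (0 <= I r)%E.
  by apply: integral_ge0 => t _; exact: orlicz_integrand_ge0.
transitivity (\int[mu]_x ((g ord0 `|x|%R)%:E * slack (f ord0) I s `|x|%R))%E.
  apply: eq_integral => x _.
  under eq_integral do rewrite orlicz_integrand_cons//.
  rewrite /slack; case: ifP => _; last first.
    by rewrite mule0 integral0_eq// => t _; rewrite mule0.
  rewrite ge0_integralZl//.
  - exact: measurable_orlicz_integrand.
  - by move=> t _; exact: orlicz_integrand_ge0.
  - by rewrite lee_fin; exact: (wg ord0).2.
rewrite (ge0_even_integral (k := fun x => ((g ord0 x)%:E * slack (f ord0) I s x)%E)); last 3 first.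
- exact: measurable_wintegrand (yf ord0) (wg ord0).1 mI.
- by move=> x; apply: wintegrand_ge0 => // y; exact: (wg ord0).2.
- by move=> x x0; rewrite slack_neg// mule0.
rewrite -/(wint _ _ _ _).
have [H0 ndH _] := profile_heaviside (ler01 : 0 <= 1 :> R).
have {}H0 r : (0 <= heaviside r)%E by have /andP[] := H0 r; rewrite mul1e.
have {}ndH r q : r <= q -> (heaviside r <= heaviside q)%E.
  by move=> /ndH; rewrite !mul1e.
have -> : wint (f ord0) (g ord0) I s =
    ((2 ^+ n)%R%:E * wint (f ord0) (g ord0) (iwint fs gs heaviside) s)%E.
  have [J0 ndJ] := iwint_nondecreasing yfs wgs H0 ndH.
  rewrite -wint_scale//; last exact: measurable_nondecreasing.
  by apply: eq_wint => // r; rewrite /I IH// iwint_scale.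
rewrite muleA -EFinM -exprS.
by rewrite -[wint _ _ (iwint _ _ _) _]/(iwint f g heaviside s) iwint_scale.
Qed.

End orlicz_integral.

(** * Exponential moments and concentration *)

Section concentration.
Context {R : realType}.
Local Notation mu := (@lebesgue_measure R).
Implicit Types (x y s la M v : R) (f : R -> \bar R) (g h : R -> R) (N : R -> \bar R).

Lemma layered_nonincreasing g : {homo g : x y / x <= y >-> y <= x} ->
  layered false g.
Proof.
move=> ndg t; split; [split|].
- move=> x y [t0 tx] [_ ty] z /andP[xz zy]; split=> //.
  exact: le_trans ty (ndg _ _ zy).
- move=> x [t0 tx] x0; exists 0; split=> //; split=> //.
  exact: le_trans tx (ndg _ _ x0).
move=> x y x0 y0 /= yx; rewrite !indicE.
case: (boolP (x \in _)) => [/set_mem[t0 tx]|_]; last by [].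
by rewrite mem_set//; split=> //; exact: le_trans tx (ndg _ _ yx).
Qed.

(** An up-set need not contain its left endpoint, which [segment] demands; the second hypothesis
    supplies it. *)
Lemma layered_nondecreasing g : {homo g : x y / x <= y} ->
  (forall t x, 0 < t -> 0 <= x -> t <= g x ->
     exists a, [/\ 0 <= a, t <= g a & forall y, 0 <= y -> t <= g y -> a <= y]) ->
  layered true g.
Proof.
move=> ndg mg t; split; [split|].
- move=> x y [t0 tx] [_ ty] z /andP[xz zy]; split=> //.
  exact: le_trans tx (ndg _ _ xz).
- move=> x [t0 tx] x0; have [a [a0 ta amin]] := mg t x t0 x0 tx.
  by exists a; split=> // y [_ ty] y0; exact: amin.
move=> x y x0 y0 /= xy; rewrite !indicE.
case: (boolP (x \in _)) => [/set_mem[t0 tx]|_]; last by [].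
by rewrite mem_set//; split=> //; exact: le_trans tx (ndg _ _ xy).
Qed.

(* The weights are only used on [0, +oo[; [Num.max x 0] makes them monotone on
   the whole line. *)
Definition expw_up (la M x : R) : R := expR (la * Num.min (Num.max x 0 ^+ 2) M).
Definition expw_down (la x : R) : R := expR (- (la * Num.max x 0 ^+ 2)).

Lemma measurable_maxsq : measurable_fun setT (fun x : R => Num.max x 0 ^+ 2).
Proof. by apply: measurable_funX; apply: measurable_maxr. Qed.

Lemma maxsq_homo : {homo (fun x : R => Num.max x 0 ^+ 2) : x y / x <= y}.
Proof.
move=> x y xy; have max0 z : 0 <= Num.max z 0 :> R by rewrite le_max lexx orbT.
by rewrite lerXn2r ?nnegrE// ge_max max0 andbT le_max xy.
Qed.

Lemma weight_expw_up la M : 0 <= la -> 0 <= M -> weight (expw_up la M).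
Proof.
move=> la0 M0; split.
  apply: measurableT_comp => //; apply: measurable_funM => //.
  by apply: measurable_minr => //; exact: measurable_maxsq.
exists (expR (la * M)) => x; rewrite expR_ge0 ler_expR ler_wpM2l//.
by rewrite ge_min lexx orbT.
Qed.

Lemma weight_expw_down la : 0 <= la -> weight (expw_down la).
Proof.
move=> la0; split.
  apply: measurableT_comp => //; apply: measurable_funN.
  by apply: measurable_funM => //; exact: measurable_maxsq.
exists 1 => x; rewrite expR_ge0 -[leRHS]expR0 ler_expR oppr_le0.
by rewrite mulr_ge0// sqr_ge0.
Qed.

Lemma layered_expw_down la : 0 <= la -> layered false (expw_down la).
Proof.
move=> la0; apply: layered_nonincreasing => x y xy.
by rewrite ler_expR lerN2 ler_wpM2l//; exact: maxsq_homo.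
Qed.

Lemma layered_expw_up la M : 0 < la -> layered true (expw_up la M).
Proof.
move=> la0; apply: layered_nondecreasing => [x y xy|t x t0 x0].
  rewrite ler_expR ler_wpM2l ?(ltW la0)// le_min !ge_min lexx orbT andbT.
  by rewrite maxsq_homo.
have E y : (t <= expw_up la M y) = (ln t / la <= Num.min (Num.max y 0 ^+ 2) M).
  by rewrite -{1}(lnK t0) ler_expR ler_pdivrMr// mulrC.
rewrite E le_min => /andP[_ cM]; set c := ln t / la in cM E *.
have mx y : 0 <= y -> Num.max y 0 = y by move=> y0; apply/max_idPl.
(* The square root of a negative real is 0, which is the right endpoint also for c < 0, where the
   layer contains the whole half-line. *)
exists (Num.sqrt c); split; first exact: sqrtr_ge0.
  rewrite E le_min cM andbT mx ?sqrtr_ge0//.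
  have [c0|c0] := leP 0 c; first by rewrite sqr_sqrtr.
  by apply: le_trans (ltW c0) (sqr_ge0 _).
move=> y y0; rewrite E le_min mx// => /andP[cy _].
by rewrite -(ger0_norm y0) -sqrtr_sqr ler_wsqrtr.
Qed.

(** From e^{-y} >= 1 - y and (1 - y) (1 + y + 2 y^2) = 1 + y^2 (1 - 2 y) >= 1. *)
Lemma expR_le_quad y : 0 <= y <= 2^-1 -> expR y <= 1 + y + 2 * y ^+ 2.
Proof.
move=> /andP[y0 y1]; have := expR_ge1Dx (- y); rewrite expRN => h.
have e0 := expR_gt0 y.
have : (1 - y) * expR y <= 1 by rewrite -ler_pdivlMr// div1r.
have : 1 <= (1 - y) * (1 + y + 2 * y ^+ 2) by nra.
move=> h1 h2; have y2 : 0 < 1 - y by lra.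
by rewrite -(ler_pM2l y2); apply: le_trans h2 h1.
Qed.

Lemma expRN_le_quad y : 0 <= y -> expR (- y) + y <= 1 + y ^+ 2.
Proof.
move=> y0; have h := expR_ge1Dx y; rewrite expRN.
have p : 0 < 1 + y by lra.
have : (expR y)^-1 <= (1 + y)^-1 by rewrite lef_pV2// posrE ?expR_gt0.
suff : (1 + y)^-1 <= 1 - y + y ^+ 2 by lra.
have y3 : 0 <= y ^+ 3 by rewrite exprn_ge0.
rewrite -(ler_pM2l p) mulfV ?gt_eqF//.
have -> : (1 + y) * (1 - y + y ^+ 2) = 1 + y ^+ 3 by ring.
lra.
Qed.

Lemma le_expR_sum (a : R) (X : \bar R) : (X <= (1 + a)%:E)%E ->
  (X <= (expR a)%:E)%E.
Proof. by move=> /le_trans; apply; rewrite lee_fin expR_ge1Dx. Qed.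

(** Truncation keeps the exponent below 1/2, where the quadratic bound on exp holds; its terms are
    then bounded by the untruncated second and fourth moments. *)
Lemma wint_expw_up f N s la M v (m4 : R) : young_function f -> profile N ->
  0 <= la -> 0 <= M -> la * M <= 2^-1 -> 0 <= m4 ->
  wint f (fun=> 1) N s = 1%E -> wint f (fun x => x ^+ 2) N s = v%:E ->
  (wint f (fun x => x ^+ 4)%R N s <= m4%:E)%E ->
  (wint f (expw_up la M) N s <= (expR (la * v + 2 * la ^+ 2 * m4))%:E)%E.
Proof.
move=> yf pN la0 M0 laM m40 n1 n2 n4.
have wu := weight_expw_up la0 M0.
have m2 : measurable_fun setT (fun x : R => x ^+ 2) by exact: measurable_funX.
have m4' : measurable_fun setT (fun x : R => x ^+ 4) by exact: measurable_funX.
have s2 x : 0 <= x ^+ 2 by exact: sqr_ge0.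
have s4 x : 0 <= x ^+ 4 by rewrite (exprM x 2 2) sqr_ge0.
have c0 : 0 <= 2 * la ^+ 2 by rewrite mulr_ge0.
have ma : measurable_fun setT (fun x : R => la * x ^+ 2) by exact: measurable_funM.
have mb : measurable_fun setT (fun x : R => 2 * la ^+ 2 * x ^+ 4) by exact: measurable_funM.
have a0 x : 0 <= la * x ^+ 2 by rewrite mulr_ge0.
have b0 x : 0 <= 2 * la ^+ 2 * x ^+ 4 by rewrite mulr_ge0.
apply: le_expR_sum.
apply: (@le_trans _ _ (wint f (fun x => 1 + (la * x ^+ 2 + 2 * la ^+ 2 * x ^+ 4))%R N s)).
  apply: le_wint_ge0 => //.
  - exact: wu.1.
  - by apply: measurable_funD => //; exact: measurable_funD.
  - by move=> x; exact: weight_ge0 wu.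
  move=> x x0 _; rewrite /expw_up (_ : Num.max x 0 = x); last exact/max_idPl.
  set m := Num.min _ _.
  have m0 : 0 <= m by rewrite le_min s2 M0.
  have mM : m <= M by rewrite ge_min lexx orbT.
  have mx : m <= x ^+ 2 by rewrite ge_min lexx.
  have lm : 0 <= la * m <= 2^-1.
    by rewrite mulr_ge0//=; apply: le_trans laM; rewrite ler_wpM2l.
  apply: le_trans (expR_le_quad lm) _.
  have h1 : la * m <= la * x ^+ 2 by rewrite ler_wpM2l.
  have h2 : (la * m) ^+ 2 <= la ^+ 2 * x ^+ 4.
    rewrite exprMn ler_wpM2l//; have -> : x ^+ 4 = (x ^+ 2) ^+ 2 by rewrite -exprM.
    by rewrite lerXn2r ?nnegrE.
  by rewrite -mulrA; lra.
have md : measurable_fun setT (fun x : R => la * x ^+ 2 + 2 * la ^+ 2 * x ^+ 4).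
  exact: measurable_funD.
rewrite wintD//; last by move=> x; rewrite addr_ge0.
  rewrite wintD// !wintZ// n1 n2 !EFinD; apply: leeD => //; apply: leeD => //.
  by rewrite [leRHS]EFinM; apply: lee_wpmul2l.
Qed.

(** No truncation here: the quadratic bound on e^{-y} holds for every y >= 0. *)
Lemma wint_expw_down f N s la v (m4 : R) : young_function f -> profile N ->
  0 <= la -> 0 <= m4 ->
  wint f (fun=> 1) N s = 1%E -> wint f (fun x => x ^+ 2) N s = v%:E ->
  (wint f (fun x => x ^+ 4)%R N s <= m4%:E)%E ->
  (wint f (expw_down la) N s <= (expR (- (la * v) + la ^+ 2 * m4))%:E)%E.
Proof.
move=> yf pN la0 m40 n1 n2 n4; have N0 t := profile_ge0 t pN.
have wu := weight_expw_down la0.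
have m2 : measurable_fun setT (fun x : R => x ^+ 2) by exact: measurable_funX.
have m4' : measurable_fun setT (fun x : R => x ^+ 4) by exact: measurable_funX.
have s2 x : 0 <= x ^+ 2 by exact: sqr_ge0.
have s4 x : 0 <= x ^+ 4 by rewrite (exprM x 2 2) sqr_ge0.
have ma : measurable_fun setT (fun x : R => la * x ^+ 2) by exact: measurable_funM.
have mb : measurable_fun setT (fun x : R => la ^+ 2 * x ^+ 4) by exact: measurable_funM.
have a0 x : 0 <= la * x ^+ 2 by rewrite mulr_ge0.
have b0 x : 0 <= la ^+ 2 * x ^+ 4 by rewrite mulr_ge0.
(* The linear term stays on the left, so that only nonnegative weights are integrated. *)
have key : (wint f (expw_down la) N s + (la * v)%:E <= 1 + (la ^+ 2 * m4)%:E)%E.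
  rewrite EFinM -n2 -wintZ// -wintD//; last 2 first.
  - exact: wu.1.
  - by move=> x; exact: weight_ge0 wu.
  apply: (@le_trans _ _ (wint f (fun x => 1 + la ^+ 2 * x ^+ 4)%R N s)).
    apply: le_wint_ge0 => //.
    - by apply: measurable_funD => //; exact: wu.1.
    - exact: measurable_funD.
    - by move=> x; rewrite addr_ge0//; exact: weight_ge0 wu.
    move=> x x0 _; rewrite /expw_down (_ : Num.max x 0 = x); last exact/max_idPl.
    by apply: le_trans (expRN_le_quad (a0 x)) _; rewrite exprMn -exprM.
  rewrite wintD//.
  rewrite wintZ// n1; apply: leeD => //.
  by rewrite [leRHS]EFinM; apply: lee_wpmul2l; rewrite ?lee_fin.
apply: le_expR_sum.
move: key; have := wint_ge0 f s N0 (fun x => weight_ge0 x wu).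
by case: (wint _ _ _ _) => [r| |]//=; rewrite -?EFinD !lee_fin; lra.
Qed.

End concentration.

(** * Marginals and isotropic constant of a ball of volume 1 *)

Section ball.
Context {R : realType}.
Local Notation mu := (@lebesgue_measure R).
Local Notation lam := (lebesgue_tuple R).
Implicit Types (s la M : R) (g h : R -> R) (N : R -> \bar R).

Definition base n (r : R) : \bar R := ((2 ^+ n)%R%:E * heaviside r)%E.

Lemma profile_base n : profile (base n).
Proof. by apply: profile_heaviside; exact: exprn_ge0. Qed.

Lemma logconcave_base n : logconcave (base n).
Proof. exact: logconcave_heaviside. Qed.

Lemma measurable_young_ball n (f : 'I_n -> R -> \bar R) :
  (forall i, young_function (f i)) -> measurable (orlicz_ball f).
Proof. by move=> yf; apply: measurable_orlicz_ball; exists f. Qed.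

Lemma measurable_prod_norm n (g : 'I_n -> R -> R) (D : set (n.-tuple R)) :
  (forall i, nnweight (g i)) ->
  measurable_fun D (fun x : n.-tuple R => (\prod_(i < n) g i `|tnth x i|)%:E).
Proof.
move=> wg; apply: measurable_funTS; apply/measurable_EFinP.
by apply: measurable_tuple_prod => i; exact: (wg i).1.
Qed.

Lemma integral_ball n (f : 'I_n -> R -> \bar R) (g : 'I_n -> R -> R) :
  (forall i, young_function (f i)) -> (forall i, nnweight (g i)) ->
  (\int[lam n]_(x in orlicz_ball f) (\prod_(i < n) g i `|tnth x i|)%R%:E =
   iwint f g (base n) 1)%E.
Proof.
move=> yf wg; rewrite -integral_orlicz// integral_mkcond.
apply: eq_integral => x _; rewrite patchE /orlicz_integrand.
case: ifPn => [/set_mem|/negP]; rewrite /orlicz_ball/=.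
  by move=> ->; rewrite mule1.
by move=> Kx; case: ifPn => [xK|_]; [exfalso; apply: Kx; exact: mem_set|rewrite mule0].
Qed.

Lemma integral_uniform_on n (K : set (n.-tuple R)) (h : n.-tuple R -> \bar R) :
  measurable K -> lam n K = 1%E -> measurable_fun setT h ->
  (forall x, 0 <= h x)%E ->
  (\int[uniform_on K]_x h x = \int[lam n]_(x in K) h x)%E.
Proof.
move=> mK K1 mh h0.
have UE A : uniform_on K A = lam n (A `&` K).
  by rewrite uniform_onE ?K1 ?lte01 ?ltry//= invr1 mule1.
have mKC : measurable (~` K) by exact: measurableC.
rewrite -(setUv K) ge0_integral_setU//=; last 2 first.
- by rewrite setUv.
- exact/disj_setPCl.
have P0 : uniform_on K (~` K) = 0%E by rewrite UE setICl measure0.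
rewrite [X in (_ + X)%E](null_set_integral mKC _ P0); last exact: measurable_funTS.
rewrite adde0; apply: eq_measure_integral => A mA AK.
have := UE A; rewrite (setIidl AK); exact.
Qed.

Lemma young_small (f : R -> \bar R) (a : R) : young_function f -> 0 < a ->
  exists2 e : R, 0 < e & (f e <= a%:E)%E.
Proof.
move=> [f0 fc fz _ [d d0 fd]] a0.
have fdf : f d \is a fin_num.
  by rewrite ge0_fin_numE ?f0 ?ltW// ltey; exact/eqP.
set m := fine (f d); have m0 : 0 <= m by rewrite fine_ge0// f0// ltW.
pose th := Num.min 1 (a / (m + 1)).
have th0 : 0 < th by rewrite lt_min ltr01 divr_gt0//; lra.
have th1 : th <= 1 by rewrite ge_min lexx.
exists (th * d); first by rewrite mulr_gt0.
have := fc d 0 th (ltW d0) (lexx _); rewrite (ltW th0) th1 => /(_ isT).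
rewrite mulr0 addr0 fz mule0 adde0 => /le_trans; apply.
rewrite -(fineK fdf) -/m -EFinM lee_fin.
have : th * (m + 1) <= a by rewrite -ler_pdivlMr; [rewrite ge_min lexx orbT|lra].
lra.
Qed.

(** By convexity between 0 and a point where it is finite, each f_i is at most 1/n near 0. *)
Lemma orlicz_ball_box n (f : 'I_n -> R -> \bar R) : (0 < n)%N ->
  (forall i, young_function (f i)) ->
  exists2 e : R, 0 < e & forall x : n.-tuple R, (forall i, `|tnth x i| < e) ->
    orlicz_ball f x.
Proof.
move=> n0 yf.
have n0R : 0 < n%:R^-1 :> R by rewrite invr_gt0 ltr0n.
have H i : exists e : R, 0 < e /\ (f i e <= (n%:R^-1)%:E)%E.
  by have [e e0 he] := young_small (yf i) n0R; exists e.
have [e he] := choice H.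
exists (\big[Num.min/1]_(i < n) e i).
  by apply/bigmin_gtP; split=> // i _; exact: (he i).1.
move=> x hx; rewrite /orlicz_ball/=.
apply: (@le_trans _ _ (\sum_(i < n) (n%:R^-1)%:E)%E).
  apply: lee_sum => i _; apply: le_trans (he i).2.
  apply: young_function_nondecreasing => //; apply: le_trans (ltW (hx i)) _.
  exact: bigmin_le.
have nn : n%:R^-1 *+ n = 1 :> R.
  by rewrite -[LHS]mulr_natr mulVf// pnatr_eq0 -lt0n.
by rewrite sumEFin sumr_const card_ord nn.
Qed.

Lemma nn_single n (k i : 'I_n) h : nnweight h -> nnweight (single k h i).
Proof. by move=> wh; rewrite /single; case: ifP => // _; exact: weight_nn weight1. Qed.

Lemma integral_ball_single n (f : 'I_n -> R -> \bar R) (k : 'I_n) h :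
  (forall i, young_function (f i)) -> nnweight h ->
  (\int[lam n]_(x in orlicz_ball f) (h `|tnth x k|)%R%:E =
   iwint f (single k h) (base n) 1)%E.
Proof.
move=> yf wh; rewrite -integral_ball//; last by move=> i; exact: nn_single.
apply: eq_integral => x _; congr (_%:E).
rewrite (bigD1 k)//= {1}/single eqxx big1 ?mulr1// => i ik.
by rewrite /single (negbTE ik).
Qed.

Lemma iwint1 n (f : 'I_n -> R -> \bar R) : (forall i, young_function (f i)) ->
  lam n (orlicz_ball f) = 1%E -> iwint f (fun i => fun=> 1) (base n) 1 = 1%E.
Proof.
move=> yf K1; rewrite -integral_ball//.
rewrite (eq_integral (cst 1%E)) => [|x _]; last by rewrite big1.
rewrite integral_cst; last exact: measurable_young_ball.
by rewrite mul1e.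
Qed.

Lemma ball_marginal n (f : 'I_n -> R -> \bar R) (k : 'I_n) :
  (forall i, young_function (f i)) -> lam n (orlicz_ball f) = 1%E ->
  exists N', [/\ profile N', logconcave N', wint (f k) (fun=> 1) N' 1 = 1%E &
    forall h, nnweight h -> iwint f (single k h) (base n) 1 = wint (f k) h N' 1].
Proof.
move=> yf K1; have [N' [pN lN H]] :=
  iwint_single k yf (profile_base n) (@logconcave_base n).
have nn1 := weight_nn (@weight1 R).
exists N'; split=> [//|//||h wh]; last exact: H.
rewrite -H// -(iwint1 yf K1); apply: eq_iwint => // i x _.
by rewrite /single; case: ifP.
Qed.

Lemma nn_sq : nnweight (fun x : R => x ^+ 2).
Proof. by split=> [|x]; [exact: measurable_funX|exact: sqr_ge0]. Qed.

(* The box [-e, e]^n inside the ball has volume (2 e)^n, while each coordinate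
   lies in [-e, e] with probability at most sqrt 2 e / L; negative dependence
   compares the two. *)
Lemma isotropic_le1 n (f : 'I_n -> R -> \bar R) (L : R) : (0 < n)%N ->
  (forall i, young_function (f i)) -> lam n (orlicz_ball f) = 1%E ->
  (forall k, iwint f (single k (fun x => x ^+ 2)) (base n) 1 = (L ^+ 2)%:E) ->
  L ^+ 2 <= 1.
Proof.
move=> n0 yf K1 n2; rewrite leNgt; apply/negP => L1.
have [e e0 he] := orlicz_ball_box n0 yf.
pose g : R -> R := \1_[set x | x < e].
have mE : measurable [set x : R | x < e].
  by rewrite (_ : [set x | x < e] = `]-oo, e[%classic)//;
    apply/seteqP; split=> x /=; rewrite in_itv.
have wg : weight g by exact: weight_indic.
have gE x : g x = (x < e)%R%:R.
  rewrite /g indicE; suff -> : (x \in [set x | x < e]) = (x < e) by [].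
  by apply/idP/idP => [/set_mem//|xe]; exact: mem_set.
have lg : layered false g.
  apply: layered_nonincreasing => x y xy; rewrite !gE.
  by have [ye|//] := ltP y e; rewrite (le_lt_trans xy ye).
have Hq k : exists q : R, [/\ 0 <= q, iwint f (single k g) (base n) 1 = q%:E &
    q ^+ 2 <= 2 * e ^+ 2].
  have [N' [pN lN n1 H]] := ball_marginal k yf K1.
  have m2 := n2 k; rewrite H in m2; last exact: nn_sq.
  have [q [q0 Eq hq]] := wint_small (yf k) pN lN e0 n1 m2.
  exists q; split=> //; first by rewrite H//; exact: weight_nn.
  have := sqr_ge0 q; nra.
have [q hq] := choice Hq.
have box : ((2 * e) ^+ n <= \prod_(i < n) q i)%R.
  rewrite -lee_fin -prodEFin.
  under eq_bigr do rewrite -(let: And3 _ E _ := hq _ in E).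
  apply: le_trans (iwint_negative_dependence (b := false) (f := f) (g := fun=> g)
    yf (fun=> wg) (fun=> lg) (profile_base n) (@logconcave_base n) (iwint1 yf K1)).
  rewrite -integral_ball//; last by move=> i; exact: weight_nn.
  pose B : set (n.-tuple R) := [set x | forall i, `]-e, e[%classic (tnth x i)].
  have BE x : B x -> forall i, `|tnth x i| < e.
    by move=> Bx i; have := Bx i; rewrite /= in_itv/= ltr_norml.
  have mB : measurable B.
    rewrite (_ : B = \bigcap_(i in [set: 'I_n]) ((fun x => tnth x i) @^-1` `]-e, e[%classic)).
      apply: fin_bigcap_measurable => // i _.
      by rewrite -[X in measurable X]setTI; exact: measurable_tnth.
    by apply/seteqP; split=> [x Bx i _|x Bx i]; [exact: Bx|exact: Bx i I].
  have -> : ((2 * e) ^+ n)%:E = lam n B.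
    have -> : lam n B = (\prod_(i < n) (2 * e)%R%:E)%E.
      have -> : (2 * e)%:E = mu `]-e, e[.
        by rewrite lebesgue_measure_itv/= lte_fin gtrN// -EFinB; congr (_%:E); ring.
      exact: (@lebesgue_tuple_box R n (fun=> `]-e, e[%classic)).
    by rewrite prodEFin prodr_const card_ord.
  have BK : B `<=` orlicz_ball f by move=> x /BE; exact: he.
  have -> : lam n B = (\int[lam n]_(x in B) (\prod_(i < n) g `|tnth x i|)%R%:E)%E.
    rewrite (eq_integral (cst 1%E)) ?integral_cst ?mul1e// => x /set_mem /BE xB.
    by rewrite big1// => i _; rewrite gE xB.
  apply: ge0_subset_integral => //.
  - exact: measurable_young_ball.
  - by apply: (measurable_prod_norm (g := fun=> g)) => i; exact: weight_nn.
  - by move=> x _; rewrite lee_fin; apply: prodr_ge0 => i _; exact: weight_ge0.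
(* Squared, the box bound reads (4 e^2)^n <= (2 e^2)^n, which is impossible for n > 0. *)
have h1 : ((2 * e) ^+ n) ^+ 2 <= (2 * e ^+ 2) ^+ n.
  apply: (@le_trans _ _ ((\prod_(i < n) q i) ^+ 2)).
    rewrite lerXn2r// nnegrE ?exprn_ge0 ?mulr_ge0 ?(ltW e0)//.
    by apply: prodr_ge0 => i _; case: (hq i).
  rewrite -prodrXl -[n in leRHS]card_ord -prodr_const.
  by apply: ler_prod => i _; rewrite sqr_ge0; case: (hq i).
have : (2 * e ^+ 2) ^+ n < ((2 * e) ^+ n) ^+ 2.
  rewrite exprAC ltrXn2r -?lt0n// ?nnegrE//; nra.
by rewrite ltNge h1.
Qed.

End ball.

(** * Chernoff bounds for the mean of the squares *)

Lemma lee_prod (R : realType) n (F G : 'I_n -> \bar R) :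
  (forall i, 0 <= F i <= G i)%E -> (\prod_(i < n) F i <= \prod_(i < n) G i)%E.
Proof.
move=> FG.
suff /andP[] : (0 <= \prod_(i < n) F i <= \prod_(i < n) G i)%E by [].
elim/big_ind2 : _ => //[|x x' y y' /andP[x0 xx'] /andP[y0 yy']].
  by rewrite lee01 lexx.
by rewrite mule_ge0// lee_pmul.
Qed.

Section deviation.
Context {R : realType}.
Local Notation lam := (lebesgue_tuple R).
Variables (n : nat) (f : 'I_n -> R -> \bar R) (L t : R).
Hypothesis n_gt0 : (0 < n)%N.
Hypothesis yf : forall i, young_function (f i).
Hypothesis vol1 : lam n (orlicz_ball f) = 1%E.
Hypothesis second_moment :
  forall k, iwint f (single k (fun x => x ^+ 2)) (base n) 1 = (L ^+ 2)%:E.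
Hypothesis t_gt0 : 0 < t.

Let c4 : R := 2 ^+ 18.

Let c4_gt0 : 0 < c4. Proof. exact: exprn_gt0. Qed.

Let nR_gt0 : 0 < n%:R :> R. Proof. by rewrite ltr0n. Qed.

Let L1 : L ^+ 2 <= 1. Proof. exact: isotropic_le1 second_moment. Qed.

Lemma nn_tail (u : R) : nnweight (fun x : R => (u <= x)%R%:R).
Proof. by split=> //; exact: measurable_tail. Qed.

Lemma single_facts k : exists N', [/\ profile N' /\ wint (f k) (fun=> 1) N' 1 = 1%E,
  wint (f k) (fun x => x ^+ 2) N' 1 = (L ^+ 2)%:E,
  (wint (f k) (fun x => x ^+ 4)%R N' 1 <= c4%:E)%E,
  (forall u, wint (f k) (fun x => (u <= x)%R%:R)%R N' 1 <=
    (4 * expR (- (u / 4)))%:E)%E &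
  forall h, nnweight h -> iwint f (single k h) (base n) 1 = wint (f k) h N' 1].
Proof.
have [N' [pN lN n1 H]] := ball_marginal k yf vol1.
have n2 := second_moment k; rewrite H in n2; last exact: nn_sq.
have n2' : (wint (f k) (fun x => x ^+ 2)%R N' 1 <= 1)%E by rewrite n2 lee_fin.
exists N'; split=> //; first exact: wint_fourth_moment.
by move=> u; exact: wint_tail.
Qed.

Lemma ball_tail (k : 'I_n) (u : R) :
  (\int[lam n]_(x in orlicz_ball f) ((u <= `|tnth x k|)%R%:R)%R%:E <=
   (4 * expR (- (u / 4)))%:E)%E.
Proof.
have [N' [_ _ _ tl H]] := single_facts k.
rewrite (integral_ball_single _ yf (nn_tail u)).
by rewrite H//; exact: nn_tail.
Qed.

Lemma ball_exp_up (la M : R) : 0 < la -> 0 <= M -> la * M <= 2^-1 ->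
  (\int[lam n]_(x in orlicz_ball f) (\prod_(i < n) expw_up la M `|tnth x i|)%R%:E <=
   (expR (n%:R * (la * L ^+ 2 + 2 * la ^+ 2 * c4)))%:E)%E.
Proof.
move=> la0 M0 laM; have wu := weight_expw_up (ltW la0) M0.
rewrite (integral_ball (g := fun=> expw_up la M))//; last by move=> i; exact: weight_nn.
apply: le_trans (iwint_negative_dependence (b := true) (f := f) (g := fun=> expw_up la M)
  yf (fun=> wu) (fun=> layered_expw_up M la0) (profile_base n)
  (@logconcave_base _ n) (iwint1 yf vol1)) _.
apply: (@le_trans _ _ (\prod_(i < n) (expR (la * L ^+ 2 + 2 * la ^+ 2 * c4))%:E)%E).
  apply: lee_prod => i; have [N' [[pN n1] n2 n4 _ H]] := single_facts i.
  have wnn := weight_nn wu.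
  rewrite H//; apply/andP; split.
    by apply: wint_ge0 => [s|x]; [exact: profile_ge0|exact: weight_ge0].
  by apply: wint_expw_up => //; exact: ltW.
by rewrite prodEFin prodr_const card_ord -expRM_natl.
Qed.

Lemma ball_exp_down (la : R) : 0 <= la ->
  (\int[lam n]_(x in orlicz_ball f) (\prod_(i < n) expw_down la `|tnth x i|)%R%:E <=
   (expR (n%:R * (- (la * L ^+ 2) + la ^+ 2 * c4)))%:E)%E.
Proof.
move=> la0; have wu := weight_expw_down la0.
rewrite (integral_ball (g := fun=> expw_down la))//; last by move=> i; exact: weight_nn.
apply: le_trans (iwint_negative_dependence (b := false) (f := f) (g := fun=> expw_down la)
  yf (fun=> wu) (fun=> layered_expw_down la0) (profile_base n)
  (@logconcave_base _ n) (iwint1 yf vol1)) _.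
apply: (@le_trans _ _ (\prod_(i < n) (expR (- (la * L ^+ 2) + la ^+ 2 * c4))%:E)%E).
  apply: lee_prod => i; have [N' [[pN n1] n2 n4 _ H]] := single_facts i.
  have wnn := weight_nn wu.
  rewrite H//; apply/andP; split.
    by apply: wint_ge0 => [s|x]; [exact: profile_ge0|exact: weight_ge0].
  by apply: wint_expw_down => //; exact: ltW.
by rewrite prodEFin prodr_const card_ord -expRM_natl.
Qed.

Let u : R := (n%:R * t) `^ 3^-1.

Let u_gt0 : 0 < u. Proof. by rewrite powR_gt0// mulr_gt0. Qed.

Let u3 : u ^+ 3 = n%:R * t.
Proof.
rewrite -powR_mulrn ?(ltW u_gt0)// /u -powRrM mulVf ?pnatr_eq0// powRr1//.
by rewrite mulr_ge0// ltW.
Qed.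

(** The first argument maximises la (t - 2 la c4), the exponent left by the quadratic estimate; the
    second is the largest value with la u^2 <= 1/2. *)
Let la1 : R := Num.min (t / (4 * c4)) (2 * u ^+ 2)^-1.
(** Half of the optimal t / (2 c4), but it already gives the rate 3 / (16 c4) >= 1 / (8 c4). *)
Let la2 : R := t / (4 * c4).

Let la2_gt0 : 0 < la2. Proof. by rewrite divr_gt0// mulr_gt0. Qed.

Let la1_gt0 : 0 < la1.
Proof. by rewrite lt_min la2_gt0 invr_gt0 mulr_gt0// exprn_gt0. Qed.

(** Chernoff thresholds: la1 and la2 times the values of the sum of squares at which the mean
    deviates by t, upwards and downwards. *)
Let a1 : R := la1 * (n%:R * (L ^+ 2 + t)).
Let a2 : R := la2 * (n%:R * (L ^+ 2 - t)).

(** Since 2 la1 c4 <= t / 2, the exponent is at most - n la1 t / 2. This is - n t^2 / (8 c4) or - u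
    / 4, according to which argument realises the minimum in [la1]; the sum on the right covers
    both. *)
Lemma exponent_up :
  expR (- a1 + n%:R * (la1 * L ^+ 2 + 2 * la1 ^+ 2 * c4)) <=
  expR (- ((8 * c4)^-1 * n%:R * t ^+ 2)) + expR (- (u / 4)).
Proof.
have -> : - a1 + n%:R * (la1 * L ^+ 2 + 2 * la1 ^+ 2 * c4) =
    - (n%:R * la1 * (t - 2 * la1 * c4)) by rewrite /a1; ring.
have h : la1 * (4 * c4) <= t by rewrite -ler_pdivlMr ?mulr_gt0// ge_min lexx.
have h2 : expR (- (n%:R * la1 * (t - 2 * la1 * c4))) <= expR (- (n%:R * la1 * (t / 2))).
  rewrite ler_expR lerN2 ler_wpM2l//; last by lra.
  by rewrite mulr_ge0// ltW.
apply: (le_trans h2).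
have [E|E] : la1 = t / (4 * c4) \/ la1 = (2 * u ^+ 2)^-1.
  by rewrite /la1; case: (leP (t / (4 * c4)) _); [left|right].
- apply: ler_wpDr; first exact: expR_ge0.
  rewrite ler_expR lerN2 E le_eqVlt; apply/orP; left; apply/eqP.
  by field; rewrite gt_eqF.
- apply: ler_wpDl; first exact: expR_ge0.
  rewrite ler_expR lerN2 E le_eqVlt; apply/orP; left; apply/eqP.
  have -> : n%:R * (2 * u ^+ 2)^-1 * (t / 2) = (n%:R * t) / (4 * u ^+ 2).
    by field; rewrite gt_eqF.
  by rewrite -u3; field; rewrite gt_eqF.
Qed.

Lemma exponent_down :
  expR (a2 + n%:R * (- (la2 * L ^+ 2) + la2 ^+ 2 * c4)) <=
  expR (- ((8 * c4)^-1 * n%:R * t ^+ 2)).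
Proof.
rewrite ler_expR.
have -> : a2 + n%:R * (- (la2 * L ^+ 2) + la2 ^+ 2 * c4) =
    - (3 / (16 * c4) * n%:R * t ^+ 2).
  by rewrite /a2 /la2; field; rewrite gt_eqF.
rewrite lerN2 ler_wpM2r ?sqr_ge0// ler_wpM2r ?(ltW nR_gt0)//.
have -> : (8 * c4)^-1 = 2 / (16 * c4) by field; rewrite gt_eqF.
by rewrite ler_pM2r ?invr_gt0 ?mulr_gt0//; lra.
Qed.

Definition deviates (x : n.-tuple R) :=
  t < `|(\sum_(i < n) tnth x i ^+ 2) / n%:R - L ^+ 2|.

Lemma measurable_deviates : measurable [set x | deviates x].
Proof.
pose h (x : n.-tuple R) := `|(\sum_(i < n) tnth x i ^+ 2) / n%:R - L ^+ 2|.
have mh : measurable_fun setT h.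
  apply: measurableT_comp => //; apply: measurable_funB => //.
  apply: measurable_funM => //; apply: measurable_sum => i.
  by apply: measurable_funX; exact: measurable_tnth.
rewrite (_ : [set x | deviates x] = h @^-1` `]t, +oo[).
  by rewrite -[X in measurable X]setTI; apply: mh => //; exact: measurable_itv.
by apply/seteqP; split=> x /=; rewrite in_itv/= andbT.
Qed.

(* Markov's inequality, pointwise: a deviation forces a large coordinate, or one
   of the two exponential weights to be at least 1. *)
Lemma deviates_le (x : n.-tuple R) :
  ((\1_[set x | deviates x] x)%:E <=
   \sum_(k < n) ((u <= `|tnth x k|)%R%:R)%R%:E +
   ((expR (- a1))%:E * (\prod_(i < n) expw_up la1 (u ^+ 2) `|tnth x i|)%R%:E +
    (expR a2)%:E * (\prod_(i < n) expw_down la2 `|tnth x i|)%R%:E))%E.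
Proof.
have pu0 : 0 <= \prod_(i < n) expw_up la1 (u ^+ 2) `|tnth x i|.
  by apply: prodr_ge0 => i _; exact: expR_ge0.
have pd0 : 0 <= \prod_(i < n) expw_down la2 `|tnth x i|.
  by apply: prodr_ge0 => i _; exact: expR_ge0.
have eu0 := expR_ge0 (- a1); have ed0 := expR_ge0 a2.
rewrite sumEFin -!EFinM -!EFinD lee_fin indicE.
have s0 : 0 <= \sum_(k < n) (u <= `|tnth x k|)%R%:R :> R by apply: sumr_ge0.
case: (boolP (x \in _)) => [/set_mem/= dev|_]; last first.
  by rewrite addr_ge0// addr_ge0// mulr_ge0.
have [/existsP[k uk]|] := boolP [exists k, u <= `|tnth x k|].
  rewrite (bigD1 k)//= uk -addrA; apply: ler_wpDr => //.
  rewrite addr_ge0// ?addr_ge0// ?mulr_ge0//.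
  by apply: sumr_ge0.
rewrite negb_exists => /forallP small.
(* Below [u] the truncation at u^2 is inactive. *)
have upE i : expw_up la1 (u ^+ 2) `|tnth x i| = expR (la1 * tnth x i ^+ 2).
  rewrite /expw_up (_ : Num.max _ 0 = `|tnth x i|); last exact/max_idPl.
  have := small i; rewrite -ltNge => xu.
  have xu2 : `|tnth x i| ^+ 2 <= u ^+ 2.
    by apply: lerXn2r; rewrite ?nnegrE ?(ltW u_gt0) ?(ltW xu).
  by rewrite (min_idPl xu2) real_normK ?num_real.
have downE i : expw_down la2 `|tnth x i| = expR (- (la2 * tnth x i ^+ 2)).
  rewrite /expw_down (_ : Num.max _ 0 = `|tnth x i|); last exact/max_idPl.
  by rewrite real_normK ?num_real.
rewrite (eq_bigr _ (fun i _ => upE i)) (eq_bigr _ (fun i _ => downE i)).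
rewrite -!expR_sum -!expRD sumrN -!mulr_sumr.
set S := \sum_(i < n) tnth x i ^+ 2 in dev *.
have : n%:R * (L ^+ 2 + t) <= S \/ S <= n%:R * (L ^+ 2 - t).
  move: dev; rewrite /deviates -/S lter_normr => /orP[h|h].
    by left; rewrite mulrC -ler_pdivlMr//; lra.
  by right; rewrite mulrC -ler_pdivrMr//; lra.
move=> [h|h]; apply: ler_wpDl => //.
  apply: ler_wpDr; first exact: expR_ge0.
  rewrite -[leLHS]expR0 ler_expR /a1.
  by have := ler_wpM2l (ltW la1_gt0) h; lra.
apply: ler_wpDl; first exact: expR_ge0.
rewrite -[leLHS]expR0 ler_expR /a2.
by have := ler_wpM2l (ltW la2_gt0) h; lra.
Qed.

Lemma volume_deviates :
  (lam n ([set x | deviates x] `&` orlicz_ball f) <=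
   (5 * expR (- ((8 * c4)^-1 * n%:R * t ^+ 2)) +
    5 * n%:R * expR (- ((8 * c4)^-1 * u)))%:E)%E.
Proof.
have mK : measurable (orlicz_ball f) by exact: measurable_young_ball.
have mA := measurable_deviates.
have wu := weight_expw_up (ltW la1_gt0) (sqr_ge0 u).
have wd := weight_expw_down (ltW la2_gt0).
have mu' : measurable_fun (orlicz_ball f) (fun x : n.-tuple R =>
    (\prod_(i < n) expw_up la1 (u ^+ 2) `|tnth x i|)%:E).
  by apply: (measurable_prod_norm (g := fun=> _)) => i; exact: weight_nn.
have md' : measurable_fun (orlicz_ball f) (fun x : n.-tuple R =>
    (\prod_(i < n) expw_down la2 `|tnth x i|)%:E).
  by apply: (measurable_prod_norm (g := fun=> _)) => i; exact: weight_nn.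
have pu0 x : (0 <= (\prod_(i < n) expw_up la1 (u ^+ 2) `|tnth x i|)%:E)%E.
  by rewrite lee_fin; apply: prodr_ge0 => i _; exact: expR_ge0.
have pd0 x : (0 <= (\prod_(i < n) expw_down la2 `|tnth x i|)%:E)%E.
  by rewrite lee_fin; apply: prodr_ge0 => i _; exact: expR_ge0.
have mt k : measurable_fun (orlicz_ball f)
    (fun x : n.-tuple R => ((u <= `|tnth x k|)%R%:R)%R%:E : \bar R).
  apply: measurable_funTS; apply/measurable_EFinP.
  apply: (measurableT_comp (measurable_tail u)); apply: measurableT_comp => //.
  exact: measurable_tnth.
have eu0 := expR_ge0 (- a1); have ed0 := expR_ge0 a2.
rewrite -integral_indic//.
apply: (@le_trans _ _ (\int[lam n]_(x in orlicz_ball f)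
   (\sum_(k < n) ((u <= `|tnth x k|)%R%:R)%R%:E +
   ((expR (- a1))%:E * (\prod_(i < n) expw_up la1 (u ^+ 2) `|tnth x i|)%R%:E +
    (expR a2)%:E * (\prod_(i < n) expw_down la2 `|tnth x i|)%R%:E)))%E).
  apply: ge0_le_integral => //.
  - by apply/measurable_EFinP; exact: measurable_indic.
  - apply: emeasurable_funD; first exact: emeasurable_sum.
    by apply: emeasurable_funD; exact: emeasurable_funM.
  - by move=> x _; exact: deviates_le.
rewrite ge0_integralD//; last 4 first.
- by move=> x _; apply: sume_ge0.
- exact: emeasurable_sum.
- by move=> x _; rewrite adde_ge0// mule_ge0// lee_fin.
- by apply: emeasurable_funD; exact: emeasurable_funM.
rewrite ge0_integral_sum// ge0_integralD//; last 4 first.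
- by move=> x _; rewrite mule_ge0// lee_fin.
- exact: emeasurable_funM.
- by move=> x _; rewrite mule_ge0// lee_fin.
- exact: emeasurable_funM.
rewrite !ge0_integralZl//.
have la1M : la1 * u ^+ 2 <= 2^-1.
  have up : 0 < u ^+ 2 by rewrite exprn_gt0.
  rewrite -ler_pdivlMr//.
  have -> : 2^-1 / u ^+ 2 = (2 * u ^+ 2)^-1 by field; rewrite gt_eqF.
  by rewrite ge_min lexx orbT.
have h1 : (\sum_(k < n) \int[lam n]_(x in orlicz_ball f)
     ((u <= `|tnth x k|)%R%:R)%R%:E <= (n%:R * (4 * expR (- (u / 4))))%:E)%E.
  apply: (@le_trans _ _ (\sum_(k < n) (4 * expR (- (u / 4)))%:E)%E).
    by apply: lee_sum => k _; exact: ball_tail.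
  by rewrite sumEFin sumr_const card_ord -[X in X%:E]mulr_natl.
have h2 := lee_wpmul2l (_ : 0 <= (expR (- a1))%:E)%E
  (ball_exp_up la1_gt0 (sqr_ge0 u) la1M).
have h3 := lee_wpmul2l (_ : 0 <= (expR a2)%:E)%E (ball_exp_down (ltW la2_gt0)).
apply: le_trans (leeD h1 (leeD (h2 _) (h3 _))) _; rewrite ?lee_fin//.
rewrite -!expRD.
(* The terms in e^{-u/4} total 4 n + 1 <= 5 n, from the union bound and from [exponent_up]. The
   Gaussian terms total 2, also at most 5. *)
apply: le_trans (lerD (lexx _) (lerD exponent_up exponent_down)) _.
have u0 := u_gt0.
(* The rate 1/4 is weakened to 1 / (8 c4), so that one constant serves both terms. *)
have eu : expR (- (u / 4)) <= expR (- ((8 * c4)^-1 * u)).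
  rewrite ler_expR lerN2 [u / 4]mulrC ler_wpM2r ?(ltW u0)//.
  rewrite lef_pV2 ?posrE ?mulr_gt0//.
  have : 1 <= c4 by rewrite /c4 exprn_ege1// ler1n.
  lra.
have n1 : 1 <= n%:R :> R by rewrite ler1n.
have e1 := expR_ge0 (- ((8 * c4)^-1 * n%:R * t ^+ 2)).
have e2 := expR_ge0 (- (u / 4)).
have := ler_wpM2l (ltW nR_gt0) eu; have := ler_wpM2r e2 n1; rewrite mul1r.
lra.
Qed.

End deviation.

Theorem corollary1p8 (R : realType) :
  exists C c : R, 0 < C /\ 0 < c /\
    forall (n : nat) (K : set (n.-tuple R)) (L : R),
      (1 <= n)%N ->
      generalized_orlicz_ball K ->
      isotropic_with_constant K L ->
    forall t : R, 0 < t ->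
    forall (d : measure_display) (T : measurableType d) (P : probability T R)
      (X : {RV P >-> n.-tuple R}),
      uniformly_distributed X K ->
      (P [set w : T |
           (t < `|(\sum_(i < n) tnth (X w) i ^+ 2) / n%:R - L ^+ 2|)%R]
       <= (C * expR (- (c * n%:R * t ^+ 2))
           + C * n%:R * expR (- (c * (n%:R * t) `^ 3^-1)))%:E)%E.
Proof.
(* Here 2^18 is the universal bound on the fourth moments of the coordinates. *)
exists 5, (8 * 2 ^+ 18)^-1; split; first by [].
split; first by rewrite invr_gt0 mulr_gt0// exprn_gt0.
move=> n K L n0 [f yf ->] [K1 _ m2] t t0 d T P X UX.
have mK : measurable (orlicz_ball f) by exact: measurable_young_ball.
(* The isotropy condition, an expectation under the uniform law, is rewritten as a slice
   integral. *)
have E2 k : iwint f (single k (fun x => x ^+ 2)) (base n) 1 = (L ^+ 2)%:E.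
  rewrite -integral_ball_single//; last exact: nn_sq.
  rewrite -(m2 k) unlock integral_uniform_on//.
  - by apply: eq_integral => x _; rewrite real_normK// num_real.
  - by apply/measurable_EFinP; apply: measurable_funX; exact: measurable_tnth.
  - by move=> x; rewrite lee_fin sqr_ge0.
have := UX _ (@measurable_deviates R n L t).
rewrite /distribution /pushforward/= => ->.
rewrite uniform_onE ?K1 ?lte01 ?ltry//= invr1 mule1.
exact: volume_deviates.
Qed.
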